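(* Let $G$ be a finite abelian group, let $h\in\mathcal{B}_G$, and let $N\in\mathbb{N}$ be such that for all $n\ge N$, $h_n$ is an accumulation point of $(h_n)_{n\ge1}$ and $h_{-n}$ is an accumulation point of $(h_{-n})_{n\ge1}$. Let $G'$ be the subgroup of $G$ generated by $\sum_{k=-N}^{N-1}(-1)^k h_k$ and by all elements of the form $g-g'$, where each of $g$ and $g'$ is an accumulation point of one of the sequences $(h_n)_{n\ge1}$ and $(h_{-n})_{n\ge1}$. Then for any $g,g'\in G$, the lower right corners of the copies $g$ and $g'$ in $Y_h$ are identified if and only if $g-g'\in G'$. In particular, the number of ends of $Y_h$ is $[G:G']$.
   Context: Chamanara surface: take the open unit square $(0,1)^2$ and, for each $n\ge 1$, add open boundary segments and glue them by translations: the left segment $\{0\}\times(1-2^{1-n},1-2^{-n})$ is glued to the right segment $\{1\}\times(2^{-n},2^{1-n})$, giving a vertical segment $a_n$; the bottom segment $(1-2^{1-n},1-2^{-n})\times\{0\}$ is glued to the top segment $(2^{-n},2^{1-n})\times\{1\}$, giving a horizontal segment $b_n$. The result $X$ (endpoints of segments and corners not included) is a translation surface. For an additively written group $G$, $\mathcal{B}_G=\{(h_i)\in G^{\mathbb{Z}} : \langle h_i\mid i\in\mathbb{Z}\rangle=G,\ h_0=0\}$. For $h\in\mathcal{B}_G$ with $G$ abelian, $Y_h\to X$ is the connected normal cover with deck group $G$ obtained from copies of the square labelled by $g\in G$ (''copy $g$'') as follows: for all $i\ge1$ and $g\in G$, the right segment $a_i$ of copy $g$ is glued by translation to the left segment $a_i$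 of copy $g+h_i$, and the bottom segment $b_i$ of copy $g$ is glued by translation to the top segment $b_i$ of copy $g+h_{-i}$. $Y_h$ carries the induced flat metric, with path distance $d$. Let $x_n^g$ be the point with coordinates $(1-2^{-n},2^{-n})$ in copy $g$. The lower right corner of copy $g$ is the limit of $x_n^g$ ($n\to\infty$) in the metric completion of $Y_h$; the lower right corners of copies $g$ and $g'$ are identified if they are the same point of the metric completion, i.e. $d(x_n^g,x_n^{g'})\to0$. An accumulation point of a sequence in the finite group $G$ is an element occurring infinitely often in the sequence. Ends are topological ends of the surface. *)

(* Defs.v *)
From HB Require Import structures.
From Stdlib Require Import Relations.Relation_Operators.
From mathcomp Require Import all_boot all_order all_algebra all_fingroup.
From mathcomp Require Import all_classical all_reals all_analysis.

Set Implicit Arguments.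
Unset Strict Implicit.
Unset Printing Implicit Defensive.

Import Order.TTheory GRing.Theory Num.Theory.
Import numFieldNormedType.Exports.

Local Open Scope classical_set_scope.
Local Open Scope card_scope.
Local Open Scope ring_scope.

(* [basic_seqs G] is the set B_G.  A finite additive group is also a finite
   group in the sense of fingroup, with + as its law, so that <<A>>%g is the
   additive subgroup generated by A. *)
Definition basic_seqs (G : finZmodType) : set (int -> G) :=
  [set h | <<[set g : G | `[< exists i : int, h i = g >]]%SET>>%g = [set: G]%SET
           /\ h 0 = 0].

Section ChamanaraSquare.
Variable R : realType.

(* Segments are numbered from 0: the segments with index n below are the a_i
   and b_i with i = n + 1, so that 2^(1-i) = 2^-n and 2^-i = 2^-(n+1). *)
Definition left_seg (n : nat) : set (R * R) :=
  [set p | p.1 = 0 /\ 1 - 2 ^- n < p.2 < 1 - 2 ^- n.+1].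
Definition right_seg (n : nat) : set (R * R) :=
  [set p | p.1 = 1 /\ 2 ^- n.+1 < p.2 < 2 ^- n].
Definition bottom_seg (n : nat) : set (R * R) :=
  [set p | 1 - 2 ^- n < p.1 < 1 - 2 ^- n.+1 /\ p.2 = 0].
Definition top_seg (n : nat) : set (R * R) :=
  [set p | 2 ^- n.+1 < p.1 < 2 ^- n /\ p.2 = 1].

Definition open_square : set (R * R) :=
  [set p | 0 < p.1 < 1 /\ 0 < p.2 < 1].

Definition bordered_square : set (R * R) :=
  open_square `|` \bigcup_n (left_seg n `|` right_seg n
                             `|` bottom_seg n `|` top_seg n).

(* Signed displacement, along the segment, from right a_i to left a_i and from
   top b_i to bottom b_i, where i = n + 1: it is (1 - 2^(1-i)) - 2^-i. *)
Definition seg_shift (n : nat) : R := 1 - 2 ^- n - 2 ^- n.+1.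

Definition euclid_dist (p q : R * R) : R :=
  Num.sqrt ((p.1 - q.1) ^+ 2 + (p.2 - q.2) ^+ 2).

Definition straight_segment (p q : R * R) : set (R * R) :=
  [set (line_path p.1 q.1 t, line_path p.2 q.2 t) | t in `[0, 1]].

(* The point (1 - 2^-i, 2^-i) with i = n + 1; for i = 0 it would be the upper
   left corner, which is not in the square. *)
Definition corner_pt (n : nat) : R * R := (1 - 2 ^- n.+1, 2 ^- n.+1).

Lemma corner_pt_in n : corner_pt n \in bordered_square.
Proof.
have h0 : 0 < 2 ^- n.+1 :> R by rewrite invr_gt0 exprn_gt0.
have h1 : 2 ^- n.+1 < 1 :> R by rewrite invf_lt1 ?exprn_gt0 ?exprn_egt1 ?ltr1n.
apply/mem_set; left.
by rewrite /open_square /= h0 h1 subr_gt0 h1 gtrBl h0.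
Qed.

End ChamanaraSquare.

Section ChamanaraCover.
Variables (R : realType) (G : finZmodType) (h : int -> G).

(* Dependent sums carry the disjoint union topology, so the label is locally
   constant. *)
Definition copies : topologicalType := {_ : G & set_type (@bordered_square R)}.

Definition copy_pt (g : G) (p : set_type (@bordered_square R)) : copies :=
  existT _ g p.

Definition label (x : copies) : G := projT1 x.
Definition coord (x : copies) : R * R := set_val (projT2 x).

Definition glued (x y : copies) : Prop := exists n : nat,
  [\/ [/\ @right_seg R n (coord x), @left_seg R n (coord y),
          (coord y).2 = (coord x).2 + seg_shift R n
        & label y = label x + h n.+1%:Z]
    | [/\ @bottom_seg R n (coord x), @top_seg R n (coord y),
          (coord x).1 = (coord y).1 + seg_shift R n
        & label y = label x + h (- n.+1%:Z)]].

Definition same_point : rel copies :=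
  fun x y => `[< clos_refl_sym_trans copies glued x y >].

Lemma same_point_refl : reflexive same_point.
Proof. by move=> x; apply/asboolP; exact: rst_refl. Qed.

Lemma same_point_sym : symmetric same_point.
Proof.
by move=> x y; apply/asboolP/asboolP => xy; exact: rst_sym.
Qed.

Lemma same_point_trans : transitive same_point.
Proof.
move=> y x z /asboolP xy /asboolP yz; apply/asboolP.
exact: rst_trans xy yz.
Qed.

Canonical same_point_equiv :=
  EquivRel same_point same_point_refl same_point_sym same_point_trans.

(* The surface Y_h, with the quotient topology. *)
Definition chamanara_cover : topologicalType :=
  quotient_topology {eq_quot same_point_equiv}%qT.

Definition cover_pt (g : G) (p : set_type (@bordered_square R)) :
    chamanara_cover :=
  (\pi_({eq_quot same_point_equiv}) (copy_pt g p))%qT.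

(* [path_length x y l]: the flat surface contains a polygonal path of length l
   from x to y.  Each piece lies in one copy of the bordered square, and two
   consecutive pieces share an endpoint as a point of the surface. *)
Inductive path_length : chamanara_cover -> chamanara_cover -> R -> Prop :=
| path_nil x : path_length x x 0
| path_cons g p q y l :
    straight_segment (set_val p) (set_val q) `<=` @bordered_square R ->
    path_length (cover_pt g q) y l ->
    path_length (cover_pt g p) y
      (euclid_dist (set_val p) (set_val q) + l).

Definition path_dist (x y : chamanara_cover) : \bar R :=
  ereal_inf [set l%:E | l in path_length x y].

Definition corner_seq (g : G) (n : nat) : chamanara_cover :=
  cover_pt g (SigSub (corner_pt_in R n)).

Definition lower_right_corners_identified (g g' : G) : Prop :=
  path_dist (corner_seq g n) (corner_seq g' n) @[n --> \oo] --> 0%E.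

End ChamanaraCover.

(* An end of T chooses, for every compact K, a connected component of the
   complement of K, compatibly with inclusions (inverse limit of pi_0(T \ K)).
   The value at non-compact sets is irrelevant and normalised to set0. *)
Definition is_end (T : topologicalType) (e : set T -> set T) : Prop :=
  [/\ forall K, compact K ->
        exists2 x, (~` K) x & e K = connected_component (~` K) x,
      forall K L, compact K -> compact L -> K `<=` L -> e L `<=` e K
    & forall K, ~ compact K -> e K = set0].

Definition ends (T : topologicalType) : set (set T -> set T) :=
  [set e | is_end e].
Arguments ends T : clear implicits.

Section CornerSubgroup.
Variables (G : finZmodType) (h : int -> G).

(* For sequences indexed by n >= 1. *)
Definition accumulation_point (u : nat -> G) (g : G) : Prop :=
  infinite_set [set n | (1 <= n)%N /\ u n = g].

Definition pos_part (n : nat) : G := h n%:Z.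
Definition neg_part (n : nat) : G := h (- n%:Z).

Definition accumulation_points : {set G} :=
  [set g : G | `[< accumulation_point pos_part g
                   \/ accumulation_point neg_part g >]]%SET.

(* The sum over -N <= k <= N - 1 of (-1)^k h_k, reindexed by k = i - N. *)
Definition alternating_sum (N : nat) : G :=
  \sum_(i < N.*2) h (i%:Z - N%:Z) *~ ((-1 : int) ^ (i%:Z - N%:Z)).

Definition corner_subgroup (N : nat) : {group G} :=
  <<alternating_sum N |:
      [set (g - g')%R | g in accumulation_points, g' in accumulation_points]>>%G.

End CornerSubgroup.

(* Main.v *)
(* Call vertices the endpoints of the boundary segments.  A vertex of one copy
   of the square is glued to vertices of other copies along a chain, and the
   lower right corner of a copy is the limit of the vertices of its right and
   bottom sides.  Assign to each vertex of copy [g] a class in [G / G'] by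
   transporting [g] along these chains: the definition of [G'] makes this
   consistent at both ends of each chain.  In a bordered square, the vertex
   nearest to a point of a boundary segment is an endpoint of that segment (in
   the sup norm), so the sets of points within [e] of a vertex of a given class
   are well defined on [Y_h]; for small [e] they are disjoint for different
   classes, so a short path between lower right corners preserves the class.
   Conversely, small loops around the vertices of a chain realize the generators
   of [G'].  The complements of these neighbourhoods form a cofinal family of
   compact sets, and each neighbourhood of a class is a connected component of
   their union: the ends are the classes. *)
Require Import Defs.
From mathcomp Require Import all_boot all_order all_algebra all_fingroup.
From mathcomp Require Import all_classical all_reals all_analysis.
From mathcomp Require Import zify ring lra.
From Stdlib Require Import Relations.Relation_Operators.

Set Implicit Arguments.
Unset Strict Implicit.
Unset Printing Implicit Defensive.

Import Order.TTheory GRing.Theory Num.Theory.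
Import numFieldNormedType.Exports.

Local Open Scope classical_set_scope.
Local Open Scope card_scope.
Local Open Scope ring_scope.

(** * The bordered square and its vertices *)

Section Geometry.
Variable R : realType.
Implicit Types (p q v z : R * R) (b s : bool) (i j m n : nat).
Implicit Types (e r t u d a lo hi x y : R).

Local Notation "2^- n" := ((2 : R) ^- n) (at level 8, n at level 2, format "2^- n").
Local Notation square := (@bordered_square R).

Lemma pow2_gt0 n : 0 < 2^- n.
Proof. by rewrite invr_gt0 exprn_gt0. Qed.

Lemma pow2S n : 2^- n = 2^- n.+1 + 2^- n.+1.
Proof. by rewrite exprS; field; rewrite expf_neq0. Qed.

Lemma pow2_le m n : (m <= n)%N -> 2^- n <= 2^- m.
Proof. by move=> mn; rewrite lef_pV2 ?posrE ?exprn_gt0// ler_eXn2l ?ltr1n. Qed.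

Lemma pow2_le1 n : 2^- n <= 1.
Proof. by have := pow2_le (leq0n n); rewrite expr0 invr1. Qed.

Lemma pow2_lt m n : (2^- n < 2^- m) = (m < n)%N.
Proof. by rewrite ltf_pV2 ?posrE ?exprn_gt0// ltr_eXn2l ?ltr1n. Qed.

Lemma pow2_small e : 0 < e -> exists n, 2^- n < e.
Proof.
move=> e0; have [n _ ne] := near_infty_natSinv_expn_lt (PosNum e0).
by exists n; have := ne n (leqnn n); rewrite /= div1r.
Qed.

(* [side_pt b s u t] is at inward distance [u] from the side [(b, s)], at
   abscissa [t] along it; abscissas are chosen so that segment [n] of each side
   is 2^-(n+1) < t < 2^-n.  The sides are right (b = s = false), left (s only),
   bottom (b only) and top; [s] is false on those meeting at the lower right
   corner. *)
Definition side_pt b s u t : R * R :=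
  match b, s with
  | false, false => (1 - u, t)
  | false, true => (u, 1 - t)
  | true, false => (1 - t, u)
  | true, true => (t, 1 - u)
  end.

Definition in_edge n t : bool := 2^- n.+1 < t < 2^- n.

(* Gluing reverses segment [n] about its midpoint, in terms of abscissas. *)
Definition edge_opp n t : R := 2^- n + 2^- n.+1 - t.

Lemma in_edge_opp n t : in_edge n (edge_opp n t) = in_edge n t.
Proof. by rewrite /in_edge /edge_opp; apply/andP/andP; case; split; lra. Qed.

Lemma edge_oppK n : involutive (edge_opp n).
Proof. by move=> t; rewrite /edge_opp; ring. Qed.

(** Open sup-norm balls: four linear inequalities, within reach of [lra]; a move of Euclidean length
    [l] enlarges the radius by at most [l]. *)
Definition close e p q : bool :=
  [&& p.1 - e < q.1, q.1 < p.1 + e, p.2 - e < q.2 & q.2 < p.2 + e].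

Lemma close_le e r p q : e <= r -> close e p q -> close r p q.
Proof. by move=> er /and4P[? ? ? ?]; apply/and4P; split; lra. Qed.

Lemma close_sym e p q : close e p q = close e q p.
Proof. by apply/and4P/and4P => -[? ? ? ?]; split; lra. Qed.

Lemma close_refl e p : 0 < e -> close e p p.
Proof. by move=> e0; apply/and4P; split; lra. Qed.

Lemma close_trans e r p q v : close e p q -> close r q v -> close (e + r) p v.
Proof. by move=> /and4P[? ? ? ?] /and4P[? ? ? ?]; apply/and4P; split; lra. Qed.

Definition vertex b s i : R * R := side_pt b s 0 (2^- i).

Lemma close_side e b s u t u' t' :
  close e (side_pt b s u t) (side_pt b s u' t') =
  close e (u, t) (u', t').
Proof.
by rewrite /close/=; case: b s => -[]/=; apply/and4P/and4P => -[? ? ? ?];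
  split; lra.
Qed.

(** On the same side, an endpoint of the segment separates [t] from any other vertex. The opposite
    side is at distance 1. A vertex of an adjacent side is at least as far as the common corner, and
    an endpoint lies in between. *)
Lemma edge_near_vertex e b s n t b' s' i : e <= 1 -> in_edge n t ->
  close e (side_pt b s 0 t) (vertex b' s' i) ->
  exists2 j, j = n \/ j = n.+1 & close e (side_pt b s 0 t) (vertex b s j).
Proof.
move=> e1 /andP[nt tn] cl.
have [[[n0 i0] n1] i1] := (pow2_gt0 n.+1, pow2_gt0 i, pow2_le1 n, pow2_le1 i).
have e0 : 0 < e by case/and4P: cl => *; lra.
suff [j jn tj] : exists2 j, j = n \/ j = n.+1 & `|t - 2^- j| < e.
  exists j => //; rewrite close_side.
  move: tj; rewrite ltr_norml => /andP[? ?].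
  by apply/and4P; split=> /=; lra.
have [bb|bb] := eqVneq b b'; have [ss|ss] := eqVneq s s'.
- move: cl; rewrite -bb -ss close_side => /and4P/=[_ _ c1 c2].
  have [ni|ni] := leqP i n.
    exists n; first by left.
    by have := pow2_le ni; rewrite ltr_norml => ?; apply/andP; split; lra.
  exists n.+1; first by right.
  by have := pow2_le ni; rewrite ltr_norml => ?; apply/andP; split; lra.
- by case: b b' s s' bb ss cl => -[] [] []//= _ _ /and4P/=[? ? ? ?]; lra.
- exists n.+1; first by right.
  rewrite ltr_norml; apply/andP.
  by case: b b' s s' bb ss cl => -[] [] []//= _ _ /and4P/=[? ? ? ?]; split; lra.
- exists n; first by left.
  rewrite ltr_norml; apply/andP.
  by case: b b' s s' bb ss cl => -[] [] []//= _ _ /and4P/=[? ? ? ?]; split; lra.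
Qed.

(** The reversal swaps the endpoints [n] and [n.+1] and keeps distances along the segment. *)
Lemma close_edge_opp e b s n t j : j = n \/ j = n.+1 ->
  close e (side_pt b s 0 t) (vertex b s j) ->
  close e (side_pt b (~~ s) 0 (edge_opp n t))
    (vertex b (~~ s) (if j == n then n.+1 else n)).
Proof.
rewrite /edge_opp => -[->|->]; rewrite !close_side ?eqxx => /and4P/=[? ? ? ?].
  by apply/and4P; split=> /=; lra.
by rewrite gtn_eqF//; apply/and4P; split=> /=; lra.
Qed.

(** The gap below [2^- m] is [2^- m.+1], so distinct vertices this close both have index at least
    [K], near the lower right ([s = false]) or the upper left corner. The last case is one corner of
    the square named from its two sides. *)
Lemma close_vertices K e b s i b' s' i' : e <= 2^- K.+1 ->
  close e (vertex b s i) (vertex b' s' i') ->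
  [\/ [/\ b' = b, s' = s & i' = i],
      [/\ s' = s, (K <= i)%N & (K <= i')%N] |
      [/\ b' = ~~ b, s' = ~~ s, i = 0%N & i' = 0%N] ].
Proof.
move=> eK cl.
have [[[i0 i1] i0'] i1'] := (pow2_gt0 i, pow2_le1 i, pow2_gt0 i', pow2_le1 i').
have [[KS K1] K0] := (pow2S K, pow2_le1 K, pow2_gt0 K.+1).
have large m : 2^- m.+1 < e -> (K <= m)%N.
  by move=> me; rewrite leqNgt; apply/negP => /pow2_le; have := pow2S m; lra.
have apart m m' : (m < m')%N -> 2^- m - e < 2^- m' -> (K <= m)%N /\ (K <= m')%N.
  move=> mm me; have /large Km : 2^- m.+1 < e.
    by have := pow2S m; have := pow2_le mm; lra.
  by split=> //; exact: leq_trans Km (ltnW mm).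
have [bb|bb] := eqVneq b b'; have [ss|ss] := eqVneq s s'.
- move: cl; rewrite -bb -ss close_side => /and4P/=[_ _ c1 c2].
  case: (ltngtP i i') => [ii|ii|->].
  + by constructor 2; have [] := apart _ _ ii; [lra|split].
  + by constructor 2; have [] := apart _ _ ii; [lra|split].
  + by constructor 1.
- by case: b b' s s' bb ss cl => -[] [] []//= _ _ /and4P/=[? ? ? ?]; lra.
- constructor 2; rewrite -ss; split=> //; apply: large;
    have := pow2S i; have := pow2S i'; move=> ? ?;
    by case: b b' s s' bb ss cl => -[] [] []//= _ _ /and4P/=[? ? ? ?]; lra.
- constructor 3.
  have zero m : 1 - e < 2^- m -> m = 0%N.
    case: m => // m me; have := pow2_le (ltn0Sn m); have := pow2S 0.
    by rewrite expr0 invr1 => ? ?; exfalso; lra.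
  have [? ?] : i = 0%N /\ i' = 0%N.
    by split; apply: zero;
      case: b b' s s' bb ss cl => -[] [] []//= _ _ /and4P/=[? ? ? ?]; lra.
  by split=> //; case: b b' s s' bb ss {cl} => -[] [] [].
Qed.

Lemma segmentP p q z : straight_segment p q z <->
  exists a, [/\ 0 <= a <= 1, z.1 = p.1 + a * (q.1 - p.1)
               & z.2 = p.2 + a * (q.2 - p.2)].
Proof.
split=> [[a /= a01 <-]|[a [a01 z1 z2]]].
  exists a; split=> /=; rewrite ?/line_path; last 2 first.
  - ring.
  - ring.
  by rewrite in_itv/= in a01.
exists a; first by rewrite /= in_itv.
by case: z z1 z2 => z1 z2 /= -> ->; congr pair; rewrite /line_path; ring.
Qed.

Lemma convex_bounds lo hi x y a : 0 <= a <= 1 ->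
  lo < x < hi -> lo < y < hi -> lo < x + a * (y - x) < hi.
Proof.
move=> /andP[a0 a1] /andP[? ?] /andP[? ?].
have [->|aN0] := eqVneq a 0; first by apply/andP; split; lra.
have {a0 aN0}a0 : 0 < a by rewrite lt_def aN0.
by apply/andP; split; nra.
Qed.

Lemma close_segment e p q v z :
  close e v p -> close e v q -> straight_segment p q z -> close e v z.
Proof.
move=> /and4P[p1 p2 p3 p4] /and4P[q1 q2 q3 q4] /segmentP[a [a01 z1 z2]].
rewrite /close z1 z2 andbA.
have -> := convex_bounds a01 (introT andP (conj p1 p2)) (introT andP (conj q1 q2)).
exact: convex_bounds a01 (introT andP (conj p3 p4)) (introT andP (conj q3 q4)).
Qed.

Lemma euclid_dist_ge p q :
  `|q.1 - p.1| <= euclid_dist p q /\ `|q.2 - p.2| <= euclid_dist p q.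
Proof.
rewrite /euclid_dist; split; rewrite -sqrtr_sqr ler_wsqrtr//.
  by rewrite -sqrrN opprB lerDl sqr_ge0.
by rewrite -sqrrN opprB lerDr sqr_ge0.
Qed.

Lemma euclid_dist_le p q : euclid_dist p q <= `|q.1 - p.1| + `|q.2 - p.2|.
Proof.
rewrite /euclid_dist -[leRHS]ger0_norm ?addr_ge0// -sqrtr_sqr ler_wsqrtr//.
rewrite [leRHS]sqrrD !real_normK ?num_real//.
have : 0 <= `|q.1 - p.1| * `|q.2 - p.2| by rewrite mulr_ge0.
set c := _ * _ => c0; rewrite -mulr_natl; nra.
Qed.

Lemma euclid_dist_sym p q : euclid_dist p q = euclid_dist q p.
Proof. by rewrite /euclid_dist -sqrrN -(sqrrN (p.2 - _)) !opprB. Qed.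

Lemma close_move e p q v : close e p v -> close (e + euclid_dist p q) q v.
Proof.
move=> /and4P[? ? ? ?]; have [] := euclid_dist_ge p q.
by rewrite !ler_norml => /andP[? ?] /andP[? ?]; apply/and4P; split; lra.
Qed.

Lemma side_seg_sub b s n t : in_edge n t -> square (side_pt b s 0 t).
Proof.
move=> /andP[nt tn]; right; exists n => //.
by case: b s => -[]; [right|left;right|left;left;left|left;left;right];
  rewrite /left_seg /right_seg /top_seg /bottom_seg /side_pt /=; split;
  rewrite ?subr0//; apply/andP; split; lra.
Qed.

Lemma squareP p : square p <->
  open_square p \/ exists b s n t, in_edge n t /\ p = side_pt b s 0 t.
Proof.
split; last first.
  by move=> [|[b [s [n [t [nt ->]]]]]]; [left|exact: side_seg_sub nt].
move=> [|[n _]]; first by left.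
case: p => x y; rewrite /left_seg /right_seg /top_seg /bottom_seg /=.
move=> [[[]|]|] /= [xx yy]; right; rewrite /in_edge.
- exists false, true, n, (1 - y); split; first by apply/andP; split; lra.
  by rewrite /=; congr pair; lra.
- exists false, false, n, y; split => //; by rewrite /=; congr pair; lra.
- exists true, false, n, (1 - x); split; first by apply/andP; split; lra.
  by rewrite /=; congr pair; lra.
- exists true, true, n, x; split => //; by rewrite /=; congr pair; lra.
Qed.

Lemma square_bounds p : square p -> 0 <= p.1 <= 1 /\ 0 <= p.2 <= 1.
Proof.
move=> /squareP[[/andP[? ?] /andP[? ?]]|[b [s [n [t [/andP[? ?] ->]]]]]].
  by split; apply/andP; split; lra.
have [n1 n0] := (pow2_le1 n, pow2_gt0 n.+1).
by case: b s => -[] /=; split; apply/andP; split; lra.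
Qed.

Lemma open_square_sub p : open_square p -> square p.
Proof. by left. Qed.

Lemma straight_segment_sym p q : straight_segment p q = straight_segment q p.
Proof.
suff sub p' q' : straight_segment p' q' `<=` straight_segment q' p'.
  by apply/seteqP; split.
move=> z /segmentP[a [/andP[? ?] z1 z2]]; apply/segmentP; exists (1 - a).
by rewrite z1 z2; split; [apply/andP; split; lra|ring|ring].
Qed.

Lemma segment_sub_square p q : open_square p -> square q ->
  straight_segment p q `<=` square.
Proof.
move=> [/andP[? ?] /andP[? ?]] sq z /segmentP[a [/andP[a0 a1] z1 z2]].
have [-> //|aN1] := eqVneq z q.
have {}a1 : a < 1.
  rewrite lt_neqAle a1 andbT; apply: contra_neq aN1 => a1'.
  by case: q z sq z1 z2 => q1 q2 [z1 z2] /= _ -> ->; rewrite a1'; congr pair; ring.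
have [/andP[? ?] /andP[? ?]] := square_bounds sq.
by left; split; apply/andP; rewrite ?z1 ?z2; split; nra.
Qed.

(* Points approaching the vertex [(b, s, i)] along a diagonal as [d] tends to
   0, chosen to give the same points for the two names of a vertex with
   [i = 0]. *)
Definition vertex_pt b s i d : R * R := side_pt b s d (2^- i - d).

Lemma vertex_pt0 b s d : vertex_pt b s 0 d = vertex_pt (~~ b) (~~ s) 0 d.
Proof.
by rewrite /vertex_pt; case: b s => -[] /=; rewrite expr0 invr1; congr pair; ring.
Qed.

Lemma side_pt_in b s u t : 0 < u < 1 -> 0 < t < 1 -> open_square (side_pt b s u t).
Proof.
move=> /andP[? ?] /andP[? ?].
by case: b s => -[]; split=> /=; apply/andP; split; lra.
Qed.

Lemma vertex_pt_in b s i d : 0 < d < 2^- i -> open_square (vertex_pt b s i d).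
Proof.
move=> /andP[? ?]; have := pow2_le1 i => ?.
by apply: side_pt_in; apply/andP; split; lra.
Qed.

Lemma close_vertex_pt e b s i d : 0 < d < e ->
  close e (vertex_pt b s i d) (vertex b s i).
Proof.
move=> /andP[? ?]; rewrite close_side.
by apply/and4P; split=> /=; lra.
Qed.

Lemma euclid_dist_side b s u t u' t' :
  euclid_dist (side_pt b s u t) (side_pt b s u' t') <= `|u' - u| + `|t' - t|.
Proof.
apply: (le_trans (euclid_dist_le _ _)); rewrite le_eqVlt; apply/orP; left.
have E x y : `|1 - x - (1 - y)| = `|x - y|.
  by rewrite -normrN; congr `|_|; ring.
by apply/eqP; case: b s => -[] /=; rewrite E// addrC.
Qed.

Lemma corner_ptE b n : corner_pt R n = side_pt b false (2^- n.+1) (2^- n.+1).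
Proof. by case: b. Qed.

End Geometry.

(** * Label changes and classes of vertices *)

Section Subgroup.
Variables (G : finZmodType) (H : {group G}).
Implicit Types x y g : G.

Lemma subgroup0 : 0 \in H. Proof. exact: (group1 H). Qed.

Lemma subgroupD x y : x \in H -> y \in H -> x + y \in H.
Proof. exact: (@groupM _ H). Qed.

Lemma subgroupN x : x \in H -> - x \in H.
Proof. by move=> xH; have := groupVr xH. Qed.

Lemma subgroupB x y : x \in H -> y \in H -> x - y \in H.
Proof. by move=> xH yH; exact: subgroupD xH (subgroupN yH). Qed.

Lemma subgroup_trans x y g : x - y \in H -> y - g \in H -> x - g \in H.
Proof. by move=> xy yg; have := subgroupD xy yg; rewrite addrA subrK. Qed.

Lemma subgroup_sym x y : x - y \in H -> y - x \in H.
Proof. by move=> /subgroupN; rewrite opprB. Qed.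

Lemma subgroup_sign x n : (x *~ (-1) ^+ n \in H) = (x \in H).
Proof.
rewrite -signr_odd; case: odd; rewrite ?expr0 ?expr1// mulrNz mulr1z.
by apply/idP/idP => /subgroupN; rewrite ?opprK.
Qed.

End Subgroup.

Section Offsets.
Variables (G : finZmodType) (h : int -> G).
Implicit Types (b s : bool) (i j n : nat).

(* The label changes by this amount from the right or bottom segment [n] to its
   image on the left or top side. *)
Definition edge_shift b n : G := if b then h (- n.+1%:Z) else h n.+1%:Z.

(* [- alt_shift b n] and [alt_shift b n] are the label changes when turning
   around a vertex [(b, true, n)], resp. [(b, false, n)], from its side to the
   vertex of index 0 on that side of the chain of glued vertices. *)
Fixpoint alt_shift b n : G :=
  if n is m.+1 then edge_shift b m - alt_shift b m else 0.

(** The sum grows at both ends, by the terms [k = n] and [k = - n.+1], whose signs are opposite. *)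
Lemma alternating_sumS n : alternating_sum h n.+1 =
  alternating_sum h n + (h n%:Z - h (- n.+1%:Z)) *~ (-1) ^+ n.
Proof.
rewrite /alternating_sum doubleS big_ord_recl big_ord_recr /=.
rewrite mulrzBl addrCA; congr (_ + _).
  apply: eq_bigr => i _; rewrite /bump/=.
  by have -> : (1 + i)%N%:Z - n.+1%:Z = i%:Z - n%:Z by lia.
have -> : (bump 0 n.*2)%:Z - n.+1%:Z = n%:Z by rewrite /bump/= -addnn; lia.
rewrite sub0r -exprnN -exprVn invrN1 exprS mulN1r mulrNz.
by rewrite addrC.
Qed.

Hypothesis h0 : h 0 = 0.

(** Unfolded, the left-hand side is a signed sum of [h k] over [- n.+1 <= k <= n] without [k = 0],
    and [h 0 = 0] fills the gap. It is the total label change in [short_loop]. *)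
Lemma alt_shift_sum n : alt_shift false n - alt_shift true n.+1 =
  alternating_sum h n.+1 *~ (-1) ^+ n.
Proof.
elim: n => [|n IH].
  rewrite alternating_sumS /alternating_sum big_ord0 /= add0r h0 !subr0 !sub0r.
  by rewrite expr0 !mulr1z.
have -> : alt_shift false n.+1 - alt_shift true n.+2 =
    - (alt_shift false n - alt_shift true n.+1) +
    (edge_shift false n - edge_shift true n.+1).
  have E (e a e' b : G) : (e - a) - (e' - b) = - (a - b) + (e - e').
    by rewrite !opprB [LHS]addrACA [RHS]addrACA (addrC b).
  exact: E.
rewrite IH (alternating_sumS n.+1) mulrzDl -mulrzA -expr2 sqrr_sign.
by rewrite mulr1z exprS mulN1r mulrNz.
Qed.

Variables (H : {group G}) (K : nat).

(* The classes modulo [H] of the vertices of copy 0, transported along the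
   chains of glued vertices from the right vertices [K] and [K.+1], whose
   class is 0. *)
Definition offset b s i : G :=
  - alt_shift false (K + (b (+) s (+) odd i)) +
  (if s then - alt_shift b i else alt_shift b i).

Lemma offset0 b s : offset b s 0 = offset (~~ b) (~~ s) 0.
Proof. by rewrite /offset; case: b s => -[]; rewrite /= ?oppr0. Qed.

(** Gluing sends endpoint [n.+1] of a right or bottom segment [n] to endpoint [n] of its image, in
    the copy whose label is larger by [edge_shift b n]. Together with [offset_edge], classes agree
    across the segment. *)
Lemma offset_edgeS b n :
  offset b false n.+1 = edge_shift b n + offset b true n.
Proof.
by rewrite /offset addrCA /=; case: b (odd n) => -[].
Qed.

Lemma offset_edge b n :
  offset b false n = edge_shift b n + offset b true n.+1.
Proof.
rewrite /offset [RHS]addrCA /= subKr; congr (- alt_shift _ (K + _) + _).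
by case: b (odd n) => -[].
Qed.

Hypothesis evenK : ~~ odd K.
Hypothesis shiftK : forall b b' i j, (K <= i)%N -> (K <= j)%N ->
  edge_shift b i - edge_shift b' j \in H.
Hypothesis sumK : alternating_sum h K.+1 \in H.

(** Induction by steps of two from [K] and [K.+1]; each step adds a difference of two late edge
    shifts. At the base, [K] being even, the right offsets vanish and the bottom ones reduce modulo
    [H] to [alternating_sum h K.+1], up to sign. *)
Lemma offset_right_tail b i : (K <= i)%N -> offset b false i \in H.
Proof.
move=> /subnK <-; elim/ltn_ind: (_ - _)%N => -[|[|k]] IH.
- rewrite add0n /offset (negbTE evenK) addbF addbF; case: b IH => _.
    have E (e e' a a' : G) : - (e - a) + a' = - ((e - e') - (a - (e' - a'))).
      by rewrite !opprB !addrA subrK addrAC.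
    rewrite addn1 /= (E _ (edge_shift true K)).
    apply/subgroupN/subgroupB; first exact: (shiftK false true).
    have := alt_shift_sum K; rewrite /= => ->.
    by rewrite subgroup_sign.
  by rewrite addn0 addNr; exact: subgroup0.
- rewrite add1n /offset /= evenK addbF; case: b IH => _ /=; last first.
    by rewrite addn1 /= addNr; exact: subgroup0.
  rewrite addn0 addrC -opprB; apply: subgroupN.
  by have := alt_shift_sum K => /= ->; rewrite subgroup_sign.
- have -> : offset b false (k.+2 + K) = offset b false (k + K) +
      (edge_shift b (k + K).+1 - edge_shift b (k + K)).
    by rewrite /offset !addSn /= negbK opprB -[RHS]addrA; congr (_ + _); rewrite addrCA.
  apply: subgroupD; first exact: IH.
  by apply: shiftK; [rewrite leqW// leq_addl|rewrite leq_addl].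
Qed.

(** Near the upper left corner ([s = true]), an offset is one of the other tail minus an edge shift,
    and late edge shifts agree modulo [H]. *)
Lemma offset_tail b b' s i j : (K <= i)%N -> (K <= j)%N ->
  offset b s i - offset b' s j \in H.
Proof.
move=> Ki Kj; case: s; last by apply: subgroupB; exact: offset_right_tail.
have E c k : offset c true k = offset c false k.+1 - edge_shift c k.
  by rewrite offset_edgeS addrC addrA addNr add0r.
rewrite !E opprB addrACA (addrC (- _)) addrACA; apply: subgroupD.
  by apply: subgroupB; apply: offset_right_tail; apply: leqW.
exact: shiftK.
Qed.

End Offsets.

(** * Paths in the cover *)

Section Cover.
Variables (R : realType) (G : finZmodType) (h : int -> G).
Implicit Types (p q v : R * R) (b s : bool) (e r t u d l : R) (i j m n : nat).
Implicit Types (g : G) (x y z : chamanara_cover R h).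

Local Notation "2^- n" := ((2 : R) ^- n) (at level 8, n at level 2, format "2^- n").
Local Notation square := (@bordered_square R).
Local Notation cover := (chamanara_cover R h).

(* A junk value outside the bordered square. *)
Definition pt g p : cover := cover_pt h g (insubd (SigSub (corner_pt_in R 0)) p).

Lemma pt_val g (q : set_type square) : pt g (set_val q) = cover_pt h g q.
Proof. by rewrite /pt set_valE valKd. Qed.

Lemma insub_square p : square p ->
  set_val (insubd (SigSub (corner_pt_in R 0)) p) = p.
Proof. by move=> sp; rewrite set_valE insubdK//; exact: mem_set. Qed.

Lemma coverP x : exists g p, square p /\ x = pt g p.
Proof.
rewrite -[x](@reprK _ {eq_quot same_point_equiv R h}%qT).
case: (generic_quotient.repr x) => g q; exists g, (set_val q); split; first exact: set_valP.
by rewrite pt_val.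
Qed.

Lemma corner_seqE g n : corner_seq R h g n = pt g (corner_pt R n).
Proof. by rewrite /corner_seq -pt_val. Qed.

Lemma gluedP (X Y : copies R G) : glued h X Y <-> exists n b t,
  [/\ in_edge n t, Defs.coord X = side_pt b false 0 t,
      Defs.coord Y = side_pt b true 0 (edge_opp n t)
    & label Y = label X + edge_shift h b n].
Proof.
have pairE (a c a' c' : R) : a = a' -> c = c' -> (a, c) = (a', c').
  by move=> -> ->.
rewrite /glued /in_edge /edge_opp; case: (Defs.coord X) (Defs.coord Y) => [x1 x2] [y1 y2].
split=> [[n [[]|[]]]|[n [[] [t [nt]]]]].
- move=> [/= x1E xb] [/= y1E yb]; rewrite /seg_shift/= => E ->.
  by exists n, false, x2; split=> //; apply: pairE; lra.
- move=> [/= xb x2E] [/= yb y2E]; rewrite /seg_shift/= => E ->.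
  exists n, true, (1 - x1); split=> //; try by apply: pairE; lra.
  by apply/andP; split; lra.
- move=> [-> ->] [-> ->] ->; exists n; right; rewrite /seg_shift; move/andP: nt => [? ?].
  rewrite /bottom_seg /top_seg /=; split=> //; [split=> //|split|].
  + by apply/andP; split; lra.
  + by apply/andP; split; lra.
  + by lra.
  + by lra.
- move=> [-> ->] [-> ->] ->; exists n; left; rewrite /seg_shift; move/andP: nt => [? ?].
  rewrite /left_seg /right_seg /=; split=> //; [split=> //|split=> //|].
  + by lra.
  + by apply/andP; split; lra.
  + by apply/andP; split; lra.
  + by lra.
Qed.

Lemma pt_glue g b n t : in_edge n t ->
  pt g (side_pt b false 0 t) =
  pt (g + edge_shift h b n) (side_pt b true 0 (edge_opp n t)).
Proof.
move=> nt; apply/eqmodP/asboolP/rst_step/gluedP; exists n, b, t.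
by split=> //; rewrite /Defs.coord/= insub_square//;
  apply: (@side_seg_sub _ b _ n); rewrite ?in_edge_opp.
Qed.

(** The equivalence is generated by [glued], so invariance across each pair of glued segments is
    enough. *)
Lemma pt_invariant (Q : G -> R * R -> Prop) g g' p p' :
  (forall k b n t, in_edge n t -> Q k (side_pt b false 0 t) <->
     Q (k + edge_shift h b n) (side_pt b true 0 (edge_opp n t))) ->
  square p -> square p' -> pt g p = pt g' p' -> Q g p -> Q g' p'.
Proof.
move=> Qinv sp sp' /eqmodP/asboolP pp.
suff Qpp : Q g (set_val (insubd (SigSub (corner_pt_in R 0)) p)) <->
           Q g' (set_val (insubd (SigSub (corner_pt_in R 0)) p')).
  by move: Qpp; rewrite !insub_square// => -[].
pose Q' (X : copies R G) := Q (label X) (Defs.coord X).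
rewrite -[X in X <-> _]/(Q' (copy_pt _ _)) -[X in _ <-> X]/(Q' (copy_pt _ _)).
elim: pp => {p p' sp sp' g g'} [X Y /gluedP[n [b [t [nt XE YE]]]]|X|X Y _ <-|X Y Z _ -> _ <-]//.
by rewrite /Q' XE YE => ->; exact: Qinv.
Qed.

(** Actual paths instead of the infimum [path_dist], so that bounds add up under concatenation. *)
Definition short e x y : Prop := exists2 l, path_length x y l & l <= e.

Lemma path_length_ge0 x y l : path_length x y l -> 0 <= l.
Proof. by elim=> // g p q {}y {}l _ _ l0; rewrite addr_ge0// sqrtr_ge0. Qed.

Lemma short_le e r x y : e <= r -> short e x y -> short r x y.
Proof. by move=> er [l xy le]; exists l => //; exact: le_trans er. Qed.

Lemma short_refl e x : 0 <= e -> short e x x.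
Proof. by move=> e0; exists 0 => //; exact: path_nil. Qed.

Lemma short_trans e r x y z : short e x y -> short r y z -> short (e + r) x z.
Proof.
move=> [l xy le] [k yz kr]; exists (l + k); last exact: lerD.
elim: xy yz {le kr e r} => [x' yz|g p q y' l' pq _ IH yz]; first by rewrite add0r.
by rewrite -addrA; apply: path_cons => //; exact: IH.
Qed.

Lemma short_segment g p q : straight_segment p q `<=` square ->
  short (euclid_dist p q) (pt g p) (pt g q).
Proof.
move=> pq.
have sp : square p by apply: pq; apply/segmentP; exists 0; split; [lra|ring|ring].
have sq : square q by apply: pq; apply/segmentP; exists 1; split; [lra|ring|ring].
exists (euclid_dist p q + 0); last by rewrite addr0.
rewrite -[in X in X + 0](insub_square sp) -[in X in X + 0](insub_square sq).
by apply: path_cons; [rewrite !insub_square|exact: path_nil].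
Qed.

Lemma short_sym e x y : short e x y -> short e y x.
Proof.
move=> [l xy le]; apply: (short_le le); elim: xy {le e} => [x'|g p q y' l' pq _ IH].
  exact: short_refl.
rewrite addrC; apply: short_trans IH _; rewrite -!pt_val euclid_dist_sym.
by apply: short_segment; rewrite straight_segment_sym.
Qed.

Lemma identifiedP g g' : lower_right_corners_identified R h g g' <->
  forall e, 0 < e -> exists n0, forall n, (n0 <= n)%N ->
    short e (corner_seq R h g n) (corner_seq R h g' n).
Proof.
split=> [cv e e0|sh].
  have : nbhs (0 : \bar R) [set y | (y < e%:E)%E].
    by apply: open_nbhs_nbhs; split; [exact: open_ereal_lt_ereal|rewrite /= lte_fin].
  move=> /cv [n0 _ nn0]; exists n0 => n /nn0 /= /ereal_inf_lt[_ [l /= xy <-]].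
  by rewrite lte_fin => /ltW le; exists l.
move=> A [e /= e0 eA].
have [n0 nn0] := sh (e / 2) ltac:(by rewrite divr_gt0).
exists n0 => // n /= /nn0 [l xy le].
set y := path_dist _ _.
have y0 : (0 <= y)%E.
  apply: le_ereal_inf_tmp => _ [k /= /path_length_ge0 k0 <-].
  by rewrite lee_fin.
have yl : (y <= l%:E)%E by apply: ereal_inf_lbound; exists l.
case: y y0 yl => [r||]//; rewrite !lee_fin => r0 rl.
apply: eA; rewrite /ball_ /= sub0r normrN ger0_norm//.
by lra.
Qed.

End Cover.

(** * Neighbourhoods of classes of vertices, and their behaviour along short paths *)

Section Classes.
Variables (R : realType) (G : finZmodType) (h : int -> G) (H : {group G}) (K : nat).
Implicit Types (p q v : R * R) (b s : bool) (e r t u d l : R) (i j m n : nat).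
Implicit Types (g k : G) (x y z : chamanara_cover R h).

Local Notation "2^- n" := ((2 : R) ^- n) (at level 8, n at level 2, format "2^- n").
Local Notation square := (@bordered_square R).
Local Notation cover := (chamanara_cover R h).

Hypothesis h0 : h 0 = 0.
Hypothesis evenK : ~~ odd K.
Hypothesis shiftK : forall b b' i j, (K <= i)%N -> (K <= j)%N ->
  edge_shift h b i - edge_shift h b' j \in H.
Hypothesis sumK : alternating_sum h K.+1 \in H.

Local Notation offset := (offset h K).
(** Half of the bound in [offset_close]: two vertices within [eta] of one point of a copy have the
    same class. *)
Local Notation eta := (2^- K.+2).

Lemma offset_close e b s i b' s' i' : e <= 2^- K.+1 ->
  close e (vertex R b s i) (vertex R b' s' i') ->
  offset b s i - offset b' s' i' \in H.
Proof.
move=> eK /(close_vertices eK) [[-> -> ->]|[-> Ki Ki']|[-> -> -> ->]].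
- by rewrite subrr; exact: subgroup0.
- exact: offset_tail.
- by rewrite -offset0 subrr; exact: subgroup0.
Qed.

(** The vertex [(b, s, i)] of copy [g] has class [g + offset b s i] modulo [H]; [g0] represents the
    class sought. *)
Definition near_class e g0 g p : Prop := exists b s i,
  close e p (vertex R b s i) /\ g + offset b s i - g0 \in H.

Definition class_nbhd e g0 : set cover :=
  [set x | exists g p, [/\ square p, x = pt h g p & near_class e g0 g p]].

Lemma near_class_le e r g0 g p : e <= r -> near_class e g0 g p ->
  near_class r g0 g p.
Proof.
by move=> er [b [s [i [c gH]]]]; exists b, s, i; split=> //; exact: close_le er c.
Qed.

Lemma class_nbhd_le e r g0 : e <= r -> class_nbhd e g0 `<=` class_nbhd r g0.
Proof.
move=> er x [g [p [sp xE gp]]]; exists g, p; split=> //.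
exact: near_class_le er gp.
Qed.

(** By [edge_near_vertex] some endpoint of the segment is near too; it is within [2 * e] of the
    given vertex, so [offset_close] gives it the same class. *)
Lemma near_class_edge e g0 g b s n t : e <= eta -> in_edge n t ->
  near_class e g0 g (side_pt b s 0 t) -> exists2 j, j = n \/ j = n.+1 &
  close e (side_pt b s 0 t) (vertex R b s j) /\ g + offset b s j - g0 \in H.
Proof.
move=> eK nt [b' [s' [i [c gH]]]].
have e1 : e <= 1 := le_trans eK (pow2_le1 _ _).
have [j jn cj] := edge_near_vertex e1 nt c.
exists j => //; split=> //.
have c2 : close (e + e) (vertex R b s j) (vertex R b' s' i).
  by apply: close_trans c; rewrite close_sym.
have eeK : e + e <= 2^- K.+1 by rewrite (pow2S R K.+1) lerD.
have cH := offset_close eeK c2.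
have := subgroupD cH gH; congr (_ \in H).
by rewrite -(addrA g) addrCA (addrA (offset b s j - _)) subrK addrCA addrA.
Qed.

Lemma near_class_glue e g0 g b n t : e <= eta -> in_edge n t ->
  near_class e g0 g (side_pt b false 0 t) <->
  near_class e g0 (g + edge_shift h b n) (side_pt b true 0 (edge_opp n t)).
Proof.
move=> eK nt; split=> /near_class_edge.
  move=> /(_ n eK nt)[j jn [c gH]].
  exists b, true, (if j == n then n.+1 else n); split; first exact: (close_edge_opp jn c).
  by move: gH; case: jn => ->; rewrite ?eqxx ?gtn_eqF// -(addrA g (edge_shift _ _ _))
    -?offset_edge -?offset_edgeS.
move=> /(_ n eK); rewrite in_edge_opp => /(_ nt)[j jn [c gH]].
exists b, false, (if j == n then n.+1 else n); split.
  by have := close_edge_opp jn c; rewrite edge_oppK.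
by move: gH; case: jn => ->; rewrite ?eqxx ?gtn_eqF// -(addrA g (edge_shift _ _ _))
  -?offset_edge -?offset_edgeS.
Qed.

Lemma class_nbhdP e g0 g p : e <= eta -> square p ->
  class_nbhd e g0 (pt h g p) <-> near_class e g0 g p.
Proof.
move=> eK sp; split=> [[g' [p' [sp' pp' c]]]|c]; last by exists g, p.
have := @pt_invariant _ _ _ (near_class e g0) _ _ _ _ _ sp' sp (esym pp') c.
by apply=> *; exact: near_class_glue.
Qed.

(** The radius grows by the length of each piece. As it stays below [eta], [class_nbhdP] can rename
    a junction point in the next copy without changing its class. *)
Lemma class_nbhd_path x y l e g0 : path_length x y l -> e + l <= eta ->
  class_nbhd e g0 x -> class_nbhd (e + l) g0 y.
Proof.
move=> xy; elim: xy e => {x y l} [x|g p q y l pq xy IH] e.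
  by rewrite addr0.
have l0 := path_length_ge0 xy; have d0 : 0 <= euclid_dist (set_val p) (set_val q).
  exact: sqrtr_ge0.
rewrite addrA => le; rewrite -pt_val => /class_nbhdP [||b [s [i [c gH]]]].
- by lra.
- exact: set_valP.
apply: IH => //; exists g, (set_val q); split; [exact: set_valP|by rewrite pt_val|].
by exists b, s, i; split=> //; exact: close_move.
Qed.

Lemma short_class_nbhd d x y e g0 : short d x y -> e + d <= eta ->
  class_nbhd e g0 x -> class_nbhd (e + d) g0 y.
Proof.
move=> [l xy ld] ed ex; have el : e + l <= e + d by rewrite lerD2l.
exact: class_nbhd_le el _ (class_nbhd_path xy (le_trans el ed) ex).
Qed.

Lemma close_corner e n : 2^- n.+1 < e ->
  close e (corner_pt R n) (vertex R false false n.+1).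
Proof.
by move=> ne; have := pow2_gt0 R n.+1 => ?; apply/and4P; split=> /=; lra.
Qed.

(** The point is near the right vertex [n.+1], whose offset is in [H] by [offset_right_tail], so its
    class is that of [g]. *)
Lemma corner_class e g0 g n : e <= eta -> 2^- n.+1 < e ->
  class_nbhd e g0 (corner_seq R h g n) <-> g - g0 \in H.
Proof.
move=> eK ne; have Kn : (K <= n.+1)%N.
  by have := lt_le_trans ne eK; rewrite pow2_lt => /ltnW; apply: leq_trans; lia.
have tailH := offset_right_tail h0 evenK shiftK sumK false Kn.
rewrite corner_seqE class_nbhdP//; last exact/set_mem/corner_pt_in.
split=> [[b [s [i [c gH]]]]|gH]; last first.
  exists false, false, n.+1; split; first exact: close_corner.
  by rewrite addrAC; exact: subgroupD.
have c2 : close (e + e) (vertex R false false n.+1) (vertex R b s i).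
  by apply: close_trans c; rewrite close_sym; exact: close_corner.
have eeK : e + e <= 2^- K.+1 by rewrite (pow2S R K.+1) lerD.
have cH := offset_close eeK c2.
have := subgroupB (subgroupD gH cH) tailH; congr (_ \in H).
by rewrite -(addrA (g + _ - g0)) (addrAC (offset _ _ n.+1)) subrr sub0r addrAC addrK.
Qed.

Lemma identified_class g g' : lower_right_corners_identified R h g g' ->
  g - g' \in H.
Proof.
(* The initial radius [2^- K.+3] and the path length [2^- K.+3] add up to [eta]. *)
move=> /identifiedP /(_ (2^- K.+3) (pow2_gt0 _ _)) [n0 sh].
pose n := maxn n0 K.+3.
have n1 : 2^- n.+1 < 2^- K.+3 by rewrite pow2_lt ltnS leq_maxr.
have n2 : 2^- n.+1 < eta by rewrite pow2_lt ltnS (leq_trans _ (leq_maxr _ _)).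
have K3 : 2^- K.+3 + 2^- K.+3 <= eta by rewrite -pow2S.
apply/subgroup_sym; rewrite -(corner_class _ _ _ n2)//.
apply: (class_nbhd_le K3); apply: (short_class_nbhd (sh n _)) => //.
  exact: leq_maxl.
apply/corner_class => //; first by rewrite (pow2S R K.+2) lerDl ltW// pow2_gt0.
by rewrite subrr; exact: subgroup0.
Qed.

End Classes.

(** * Explicit short paths around vertices and between corners *)

Section Paths.
Variables (R : realType) (G : finZmodType) (h : int -> G).
Implicit Types (p q v : R * R) (b s : bool) (e r t u d l : R) (i j m n : nat).
Implicit Types (g k c : G) (x y z : chamanara_cover R h).

Local Notation "2^- n" := ((2 : R) ^- n) (at level 8, n at level 2, format "2^- n").
Local Notation square := (@bordered_square R).
Local Notation pt := (pt h).

Lemma short_side g b s u t u' t' : 0 < u < 1 -> 0 < t < 1 ->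
  square (side_pt b s u' t') ->
  short (`|u' - u| + `|t' - t|) (pt g (side_pt b s u t)) (pt g (side_pt b s u' t')).
Proof.
move=> u01 t01 sq; apply: short_le (euclid_dist_side b s u t u' t') _.
by apply: short_segment; apply: segment_sub_square => //; exact: side_pt_in.
Qed.

Lemma short_cross g b n t d t0 t1 : in_edge n t -> 0 < d < 1 ->
  0 < t0 < 1 -> 0 < t1 < 1 ->
  short (d + `|t - t0| + (d + `|edge_opp n t - t1|))
    (pt g (side_pt b false d t0)) (pt (g + edge_shift h b n) (side_pt b true d t1)).
Proof.
move=> nt d01 t001 t101; have d0 : `|0 - d| = d.
  by rewrite sub0r normrN ger0_norm//; case/andP: d01 => /ltW.
have n't : in_edge n (edge_opp n t) by rewrite in_edge_opp.
rewrite -[X in X + _ + _]d0 -[X in _ + (X + _)]d0; apply: short_trans (short_side _ _ _ _) _ => //.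
  exact: side_seg_sub nt.
rewrite (pt_glue h g b nt); apply: short_sym; apply: short_side => //.
exact: side_seg_sub n't.
Qed.

(** [vertex_pt] of index [n.+1] lies beside segment [n.+1], so the path first passes the vertex to
    cross segment [n] at [2^- n.+1 + d], whose image is [2^- n - d]. In [short_vertex] the vertex is
    passed after the crossing. *)
Lemma short_vertexS g b n d : 0 < d < 2^- n.+2 ->
  short (4 * d) (pt g (vertex_pt b false n.+1 d))
    (pt (g + edge_shift h b n) (vertex_pt b true n d)).
Proof.
move=> /andP[d0 dn].
have [[n1 n2] n3] := (pow2_le1 R n, pow2S R n, pow2S R n.+1).
have e1 : `|2^- n.+1 + d - (2^- n.+1 - d)| = 2 * d by rewrite ger0_norm; lra.
have e2 : `|edge_opp n (2^- n.+1 + d) - (2^- n - d)| = 0.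
  by rewrite /edge_opp; apply/normr0P/eqP; lra.
have -> : 4 * d = d + 2 * d + (d + 0) by ring.
rewrite -e1 -e2.
by apply: short_cross; apply/andP; split; lra.
Qed.

Lemma short_vertex g b n d : 0 < d < 2^- n.+2 ->
  short (4 * d) (pt g (vertex_pt b false n d))
    (pt (g + edge_shift h b n) (vertex_pt b true n.+1 d)).
Proof.
move=> /andP[d0 dn].
have [[n1 n2] n3] := (pow2_le1 R n, pow2S R n, pow2S R n.+1).
have e1 : `|2^- n - d - (2^- n - d)| = 0 by rewrite subrr normr0.
have e2 : `|edge_opp n (2^- n - d) - (2^- n.+1 - d)| = 2 * d.
  by rewrite /edge_opp ger0_norm; lra.
have -> : 4 * d = d + 0 + (d + 2 * d) by ring.
rewrite -e2 -e1.
by apply: short_cross; apply/andP; split; lra.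
Qed.

(** Each turn around a vertex costs [4 * d], lowers the index by one and changes side, whence the
    alternating recursion of [alt_shift]. *)
Lemma short_chain g b s n d : 0 < d < 2^- n.+2 ->
  short (n%:R * (4 * d)) (pt g (vertex_pt b s n d))
    (pt (g + if s then - alt_shift h b n else alt_shift h b n)
        (vertex_pt b (s (+) odd n) 0 d)).
Proof.
elim: n g s => [|n IH] g s /andP[d0 dn].
  by rewrite mul0r addbF /= oppr0 if_same addr0; exact: short_refl.
have dn' : 0 < d < 2^- n.+2.
  by rewrite d0 (lt_trans dn)// pow2_lt.
rewrite -natr1 mulrDl mul1r addrC /= addbN -addNb.
case: s.
  have -> : g - (edge_shift h b n - alt_shift h b n) =
      g - edge_shift h b n + alt_shift h b n by rewrite opprB addrA addrAC.
  have := short_vertex (g - edge_shift h b n) b dn'; rewrite subrK => /short_sym st.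
  exact: short_trans st (IH _ false dn').
apply: short_trans (short_vertexS _ _ dn') _.
by have := IH (g + edge_shift h b n) true dn'; rewrite -addrA.
Qed.

(** The chains from the right vertex [n] and the bottom vertex [n.+1] meet at index 0, where they
    reach the two names of one corner; the first is followed forwards, the second backwards. *)
Lemma short_loop g n d : 0 < d < 2^- n.+3 ->
  short ((n.+1.*2)%:R * (4 * d)) (pt g (vertex_pt false false n d))
    (pt (g + (alt_shift h false n - alt_shift h true n.+1))
        (vertex_pt true false n.+1 d)).
Proof.
move=> /andP[d0 dn]; have dn' : 0 < d < 2^- n.+2.
  by rewrite d0 (lt_trans dn)// pow2_lt.
have -> : (n.+1.*2)%:R * (4 * d) = n%:R * (4 * d) + (n.+1%:R * (4 * d) + 4 * d) :> R.
  by rewrite -addnn natrD -natr1; ring.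
apply: short_trans (short_chain g false false dn') _.
rewrite vertex_pt0.
have /= := short_chain (g + (alt_shift h false n - alt_shift h true n.+1)) true false
  (introT andP (conj d0 dn)).
rewrite addrA subrK => /short_sym; apply: short_le.
by rewrite lerDl; lra.
Qed.

Lemma short_corner g b s i m d : (i <= m)%N -> 0 < d < 2^- i ->
  short (2 * 2^- i) (pt g (side_pt b s (2^- m.+1) (2^- m.+1)))
    (pt g (vertex_pt b s i d)).
Proof.
move=> im /andP[d0 di].
have [[m0 mi] m1] := (pow2_gt0 R m.+1, pow2_le R im, pow2S R m).
have i1 := pow2_le1 R i.
apply: (@short_le _ _ _ (`|d - 2^- m.+1| + `|2^- i - d - 2^- m.+1|)).
  rewrite mulr_natl mulr2n lerD// ler_norml; apply/andP; split; lra.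
apply: short_side; try by apply/andP; split; lra.
by apply: open_square_sub; apply: vertex_pt_in; rewrite d0.
Qed.

(** The target is the diagonal point near the upper left corner, the same for both values of [b], so
    two such paths can be joined there. *)
Lemma short_corner_edge g b i m : (i < m)%N ->
  short (4 * 2^- i) (corner_seq R h g m)
    (pt (g + edge_shift h b i) (side_pt b true (2^- m.+1) (2^- m.+1))).
Proof.
move=> im; rewrite corner_seqE (corner_ptE R b).
have [[i1 i2] i3] := (pow2S R i, pow2S R i.+1, pow2S R i.+2).
have i0 := pow2_gt0 R i.+3.
pose d := 2^- i.+3.
have dE : d = 2^- i.+3 by [].
clearbody d; have di : 0 < d < 2^- i.+2 by apply/andP; split; lra.
apply: (@short_le _ _ _ (2 * 2^- i.+1 + (4 * d + 2 * 2^- i))).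
  by lra.
have [d1 d2] : 0 < d < 2^- i.+1 /\ 0 < d < 2^- i.
  by split; apply/andP; split; lra.
apply: short_trans (short_corner g b false im d1) _.
apply: short_trans (short_vertexS g b di) _.
exact/short_sym/(short_corner _ b true (ltnW im) d2).
Qed.

Lemma short_corner_loop g n e : 0 < e -> exists m0, forall m, (m0 <= m)%N ->
  short (e + 4 * 2^- n) (corner_seq R h g m)
    (corner_seq R h (g + (alt_shift h false n - alt_shift h true n.+1)) m).
Proof.
move=> e0; exists n.+1 => m nm.
set f := (n.+1.*2)%:R * 4 : R.
have f0 : 0 < f by rewrite mulr_gt0// ltr0n.
(* Shrinking [d] makes the loop itself, of length at most [f * d], cost at most [e]; [4 * 2^- n]
   pays for joining it to the corners. *)
pose d := Num.min (2^- n.+4) (e / f).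
have d0 : 0 < d by rewrite lt_min pow2_gt0 divr_gt0.
have dn : d < 2^- n.+3.
  by rewrite gt_min pow2_lt ltnSn.
have de : f * d <= e by rewrite mulrC -ler_pdivlMr// ge_min lexx orbT.
clearbody d.
have [[i1 i2] i3] := (pow2S R n, pow2S R n.+1, pow2S R n.+2).
have i0 := pow2_gt0 R n.+3.
apply: (@short_le _ _ _ (2 * 2^- n + (f * d + 2 * 2^- n.+1))).
  by lra.
have [[d1 d2] d3] : (0 < d < 2^- n /\ 0 < d < 2^- n.+1) /\ 0 < d < 2^- n.+3.
  by split; [split|]; apply/andP; split; lra.
rewrite !corner_seqE {1}(corner_ptE R false) (corner_ptE R true).
apply: short_trans (short_corner g false false (ltnW nm) d1) _.
apply: short_trans; first by rewrite /f -mulrA; exact: short_loop d3.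
exact/short_sym/(short_corner _ true false nm d2).
Qed.

Let identified g g' := lower_right_corners_identified R h g g'.

Lemma identified_refl g : identified g g.
Proof.
by apply/identifiedP => e e0; exists 0%N => n _; exact/short_refl/ltW.
Qed.

Lemma identified_trans g g' g'' :
  identified g g' -> identified g' g'' -> identified g g''.
Proof.
move=> /identifiedP gg' /identifiedP g'g''; apply/identifiedP => e e0.
have e20 : 0 < e / 2 by rewrite divr_gt0.
have [[n1 s1] [n2 s2]] := (gg' _ e20, g'g'' _ e20).
exists (maxn n1 n2) => n; rewrite geq_max => /andP[/s1 s1n /s2 s2n].
by rewrite (splitr e); exact: short_trans s1n s2n.
Qed.

Definition identified_shifts : {set G} :=
  [set k | `[< forall g, identified g (g + k) >]]%SET.

Lemma identified_shiftsP k :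
  k \in identified_shifts <-> forall g, identified g (g + k).
Proof. by rewrite inE; split=> [/asboolP|?]//; exact/asboolP. Qed.

Lemma group_set_identified_shifts : group_set identified_shifts.
Proof.
apply/group_setP; split=> [|k k' /identified_shiftsP kP /identified_shiftsP k'P].
  by apply/identified_shiftsP => g; rewrite addr0; exact: identified_refl.
apply/identified_shiftsP => g; rewrite addrA.
exact: identified_trans (kP g) (k'P _).
Qed.

Canonical identified_shifts_group := Group group_set_identified_shifts.

(** From the lower right corner of copy [g], cross a far segment of shift [c] to the upper left
    corner of copy [g + c], then return through a far segment of shift [c']. *)
Lemma identified_edges c c' :
  (forall m, exists b i, (m <= i)%N /\ edge_shift h b i = c) ->
  (forall m, exists b i, (m <= i)%N /\ edge_shift h b i = c') ->
  c - c' \in identified_shifts.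
Proof.
move=> ac ac'; apply/identified_shiftsP => g; apply/identifiedP => e e0.
have e8 : 0 < e / 8 by rewrite divr_gt0.
have [m me] := pow2_small e8.
have [[b [i [mi bi]]] [b' [j [mj bj]]]] := (ac m, ac' m).
have [im jm] := (pow2_le R mi, pow2_le R mj).
exists (maxn i j).+1 => n; rewrite gtn_max => /andP[ni nj].
apply: (@short_le _ _ _ (4 * 2^- i + 4 * 2^- j)); first by lra.
apply: short_trans (short_corner_edge g b ni) _; rewrite bi.
have := short_corner_edge (g + (c - c')) b' nj; rewrite bj addrA subrK.
by case: b b' {bi bj} => -[]; exact: short_sym.
Qed.

(** A loop realizes [alternating_sum h n.+1] only up to an error [4 * 2^- n]. Since the sums past
    [N] differ by identified shifts, [n] can be taken as large as the error requires. *)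
Lemma identified_alternating_sum N : h 0 = 0 ->
  (forall n, (N <= n)%N -> h n%:Z - h (- n.+1%:Z) \in identified_shifts) ->
  alternating_sum h N \in identified_shifts.
Proof.
move=> h0 hN.
have sumB n : (N <= n)%N ->
    alternating_sum h N - alternating_sum h n \in identified_shifts.
  move=> /subnK <-; elim: (n - N)%N => [|j IH].
    by rewrite subrr; exact: (group1 [group of identified_shifts]).
  rewrite addSn alternating_sumS opprD addrA.
  apply: (subgroupB (H := [group of identified_shifts])) => //.
  by rewrite subgroup_sign; apply: hN; rewrite leq_addl.
apply/identified_shiftsP => g; apply/identifiedP => e e0.
have e8 : 0 < e / 8 by rewrite divr_gt0.
have e4 : 0 < e / 4 by rewrite divr_gt0.
have [m me] := pow2_small e8.
(* An even [n] removes the sign in [alt_shift_sum], and [2^- n < e / 8] bounds the total by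
   [e / 4 + e / 2 + e / 4]. *)
pose n := (maxn N m).*2.
have Nn : (N <= n.+1)%N.
  by rewrite leqW// /n -addnn (leq_trans _ (leq_addl _ _))// leq_maxl.
have nm : 2^- n <= 2^- m.
  by apply: pow2_le; rewrite /n -addnn (leq_trans _ (leq_addl _ _))// leq_maxr.
have [m1 s1] := short_corner_loop g n e4.
have /identified_shiftsP /(_ (g + alternating_sum h n.+1)) := sumB _ Nn.
move=> /identifiedP /(_ _ e4)[m2 s2].
exists (maxn m1 m2) => k; rewrite geq_max => /andP[/s1 s1k /s2].
rewrite (addrC (alternating_sum _ _)) addrA addrK => s2k.
apply: short_le (short_trans s1k _); last first.
  by rewrite alt_shift_sum// -signr_odd odd_double expr0 mulr1z; exact: s2k.
by lra.
Qed.

End Paths.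

(** * Compactness and connectedness *)

Section Topology.
Variables (R : realType) (G : finZmodType) (h : int -> G).
Implicit Types (p q v : R * R) (b s : bool) (e r t u d l : R) (i j m n : nat).
Implicit Types (g k : G) (x y z : chamanara_cover R h).

Local Notation "2^- n" := ((2 : R) ^- n) (at level 8, n at level 2, format "2^- n").
Local Notation square := (@bordered_square R).
Local Notation cover := (chamanara_cover R h).
Local Notation pt := (pt h).

Lemma open_cover (V : G -> set (R * R)) (U : set cover) :
  (forall g, open (V g)) ->
  (forall g p, square p -> U (pt g p) <-> V g p) -> open U.
Proof.
move=> oV UV.
suff : open (\pi_({eq_quot same_point_equiv R h})%qT @^-1` U) by [].
apply/sigT_openP => g /=.
have -> : existT (fun=> set_type square) g @^-1`
    (\pi_({eq_quot same_point_equiv R h})%qT @^-1` U) = set_val @^-1` (V g).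
  apply/seteqP; split=> q /=; have := UV g _ (set_valP q);
    by rewrite pt_val /cover_pt /copy_pt => -[].
by apply: open_comp => // q _; exact: initial_continuous.
Qed.

(** Only within the bordered square, since [pt] has its junk value elsewhere. *)
Lemma pt_continuous g : {within square, continuous (pt g)}.
Proof.
apply/subspace_sigL_continuousP.
have -> : sigL square (pt g) = cover_pt h g.
  by apply/funext => q; rewrite /sigL /= -pt_val.
have -> : cover_pt h g = \pi_({eq_quot same_point_equiv R h})%qT \o
    existT (fun=> set_type square) g by [].
move=> q; apply: continuous_comp; first exact: existT_continuous.
exact: pi_continuous.
Qed.

Lemma straight_segment_connected p q : connected (straight_segment p q).
Proof.
apply: connected_continuous_connected; first exact: segment_connected.
apply: continuous_subspaceT => t.
have lc a c : line_path a c x @[x --> t] --> line_path a c t.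
  rewrite /line_path; apply: cvgD; apply: cvgM; rewrite ?cvg_id//.
  - by apply: cvgB; [exact: cvg_cst|exact: cvg_id].
  - exact: cvg_cst.
  - exact: cvg_cst.
exact: (cvg_pair (lc p.1 q.1) (lc p.2 q.2)).
Qed.

Lemma open_close e v : open [set p | close e p v].
Proof.
have -> : [set p | close e p v] =
    fst @^-1` `]v.1 - e, v.1 + e[ `&` snd @^-1` `]v.2 - e, v.2 + e[.
  apply/seteqP; split=> p /=; rewrite !in_itv/=.
    by move=> /and4P[? ? ? ?]; split; apply/andP; split; lra.
  by move=> [/andP[? ?] /andP[? ?]]; apply/and4P; split; lra.
by apply: openI; apply: open_comp => [? _|]; rewrite ?interval_open//;
  [exact: cvg_fst|exact: cvg_snd].
Qed.

Definition near_vertex e : set (R * R) :=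
  [set p | exists b s i, close e p (vertex R b s i)].

Lemma near_vertexE e : near_vertex e = \bigcup_(c : bool * bool * nat)
  [set p | close e p (vertex R c.1.1 c.1.2 c.2)].
Proof.
apply/seteqP; split=> p; first by move=> [b [s [i c]]]; exists (b, s, i).
by move=> [[[b s] i] _ /= c]; exists b, s, i.
Qed.

Lemma open_near_vertex e : open (near_vertex e).
Proof. by rewrite near_vertexE; apply: bigcup_open => c _; exact: open_close. Qed.

Lemma near_vertex_le e r : e <= r -> near_vertex e `<=` near_vertex r.
Proof.
by move=> er p [b [s [i c]]]; exists b, s, i; exact: close_le er c.
Qed.

Definition square_core e : set (R * R) := square `\` near_vertex e.

(** The points of the closed square missing from the bordered one are vertices or the two corners
    where vertices accumulate; all are in [near_vertex e]. *)
Lemma square_coreE e : 0 < e ->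
  square_core e = (`[0, 1] `*` `[0, 1]) `\` near_vertex e.
Proof.
move=> e0; apply/seteqP; split=> p [sp np]; split=> //.
  by have [] := square_bounds sp; split=> /=; rewrite in_itv.
move: sp => [] /=; rewrite !in_itv/= => p1 p2.
have side b s t : 0 <= t <= 1 -> p = side_pt b s 0 t -> square p.
  move=> /andP[t0 t1] pE.
  have far i : `|t - 2^- i| < e -> False.
    rewrite ltr_norml => /andP[? ?]; apply: np; exists b, s, i.
    by rewrite pE close_side; apply/and4P; split=> /=; lra.
  have tN0 : 0 < t.
    rewrite lt_def t0 andbT; apply/eqP => t0'.
    have [i ie] := pow2_small e0; apply: (far i).
    by rewrite t0' sub0r normrN ger0_norm// ltW// pow2_gt0.
  (* The least [i] with [2^- i < t] is some [n.+1], as [t <= 1], and [n] is then the index of the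
     segment containing [t]. *)
  have ex : exists i, 2^- i < t by exact: pow2_small.
  case: (ex_minnP ex) => -[|n] nt nmin; first by move: nt; rewrite expr0 invr1; lra.
  rewrite pE; apply: (@side_seg_sub _ b s n); rewrite /in_edge nt /=.
  rewrite lt_neqAle leNgt; apply/andP; split; last first.
    by apply/negP => /nmin; rewrite ltnn.
  by apply/eqP => tn; apply: (far n); rewrite tn subrr normr0.
case: p np p1 p2 side => x y /= np x01 y01 side.
have [x0|x0] := eqVneq x 0.
  apply: (side false true (1 - y)); first by apply/andP; split; lra.
  by rewrite /= x0; congr pair; ring.
have [x1|x1] := eqVneq x 1.
  by apply: (side false false y) => //; rewrite /= x1; congr pair; ring.
have [y0|y0] := eqVneq y 0.
  apply: (side true false (1 - x)); first by apply/andP; split; lra.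
  by rewrite /= y0; congr pair; ring.
have [y1|y1] := eqVneq y 1.
  by apply: (side true true x) => //; rewrite /= y1; congr pair; ring.
case/andP: x01 => xa xb; case/andP: y01 => ya yb.
by left; split=> /=; rewrite !lt_neqAle ?xa ?xb ?ya ?yb ?x1 ?y1 ?(eq_sym 0) ?x0 ?y0.
Qed.

Lemma compact_square_core e : 0 < e -> compact (square_core e).
Proof.
move=> e0; rewrite square_coreE//.
apply: subclosed_compact (compact_setX (@segment_compact R 0 1) (@segment_compact R 0 1)) _.
  rewrite setDE; apply: closedI; last exact/open_closedC/open_near_vertex.
  have -> : `[0, 1] `*` `[0, 1] = fst @^-1` `[0, 1] `&` snd @^-1` `[0, 1] :> set (R * R).
    by [].
  apply: closedI; apply: closed_comp => [? _|]; try exact: interval_closed.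
    exact: cvg_fst.
  exact: cvg_snd.
by move=> p [].
Qed.

(** In the open square, the distance to the sides works; on a segment, the distance to its endpoints
    does, by [edge_near_vertex]. *)
Lemma near_vertex_bound p : square p -> exists2 r, 0 < r & ~ near_vertex r p.
Proof.
move=> /squareP[[/andP[x0 x1] /andP[y0 y1]]|[b [s [n [t [nt ->]]]]]].
  pose r := Num.min (Num.min p.1 (1 - p.1)) (Num.min p.2 (1 - p.2)).
  have r0 : 0 < r by rewrite !lt_min !subr_gt0 x0 x1 y0 y1.
  have : [/\ r <= p.1, r <= 1 - p.1, r <= p.2 & r <= 1 - p.2].
    by rewrite /r !ge_min !lexx ?orbT.
  clearbody r => -[? ? ? ?]; exists r => // -[b [s [i]]].
  by case: b s => -[] /and4P/=[? ? ? ?]; lra.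
pose r := Num.min (t - 2^- n.+1) (2^- n - t).
case/andP: (nt) => t1 t2.
have r0 : 0 < r by rewrite !lt_min !subr_gt0 t1 t2.
have : [/\ r <= t - 2^- n.+1 & r <= 2^- n - t].
  by rewrite /r !ge_min !lexx ?orbT.
have n1 := pow2_le1 R n; have n0 := pow2_gt0 R n.+1.
clearbody r => -[? ?]; exists r => // -[b' [s' [i c]]].
have r1 : r <= 1 by lra.
have [j [->|->]] := edge_near_vertex r1 nt c; rewrite close_side => /and4P/=[? ? ? ?]; lra.
Qed.

End Topology.

(** * Ends *)

Section Ends.
Variables (R : realType) (G : finZmodType) (h : int -> G) (H : {group G}) (K : nat).
Implicit Types (p q v : R * R) (b s : bool) (e r t u d l : R) (i j m n : nat).
Implicit Types (g k : G) (x y z : chamanara_cover R h).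

Local Notation "2^- n" := ((2 : R) ^- n) (at level 8, n at level 2, format "2^- n").
Local Notation square := (@bordered_square R).
Local Notation cover := (chamanara_cover R h).
Local Notation pt := (pt h).
Local Notation eta := (2^- K.+2).
Local Notation offset := (offset h K).
Local Notation class_nbhd := (@class_nbhd R G h H K).
Local Notation near_class := (@near_class R G h H K).

Hypothesis h0 : h 0 = 0.
Hypothesis evenK : ~~ odd K.
Hypothesis shiftK : forall b b' i j, (K <= i)%N -> (K <= j)%N ->
  edge_shift h b i - edge_shift h b' j \in H.
Hypothesis sumK : alternating_sum h K.+1 \in H.
Hypothesis identifiedH : forall g g', g - g' \in H ->
  lower_right_corners_identified R h g g'.

Definition cusp e : set cover := [set x | exists g0, class_nbhd e g0 x].

Lemma cuspP e g p : e <= eta -> square p -> cusp e (pt g p) <-> near_vertex e p.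
Proof.
move=> eK sp; split=> [[g0]|[b [s [i c]]]].
  move/(class_nbhdP h0 evenK shiftK sumK _ _ eK sp) => [b [s [i [c _]]]].
  by exists b, s, i.
exists (g + offset b s i); exists g, p; split=> //; exists b, s, i; split=> //.
by rewrite subrr; exact: subgroup0.
Qed.

Lemma cusp_le e r : e <= r -> cusp e `<=` cusp r.
Proof. by move=> er x [g0 xg]; exists g0; exact: class_nbhd_le er _ xg. Qed.

Lemma open_class_nbhd e g0 : e <= eta -> open (class_nbhd e g0).
Proof.
move=> eK; apply: (@open_cover _ _ _ (fun g => [set p | near_class e g0 g p])).
  move=> g.
  have -> : [set p | near_class e g0 g p] =
      \bigcup_(c in [set c : bool * bool * nat | g + offset c.1.1 c.1.2 c.2 - g0 \in H])
        [set p | close e p (vertex R c.1.1 c.1.2 c.2)].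
    apply/seteqP; split=> p /=; first by move=> [b [s [i [? ?]]]]; exists (b, s, i).
    by move=> [[[b s] i] /= ? ?]; exists b, s, i.
  by apply: bigcup_open => c _; exact: open_close.
by move=> g p sp; exact: class_nbhdP.
Qed.

Lemma compact_core e : 0 < e -> e <= eta -> compact (~` cusp e).
Proof.
move=> e0 eK.
have -> : ~` cusp e = \big[setU/set0]_(g <- enum G) (pt g @` square_core e).
  rewrite -bigcup_seq; apply/seteqP; split=> x.
    have [g [p [sp ->]]] := coverP x => /= np; exists g; first by rewrite /= mem_enum.
    by exists p => //; split=> // /(cuspP g eK sp).
  by move=> [g _ [p [sp np] <-]] /(cuspP g eK sp).
apply: bigsetU_compact => g _; apply: continuous_compact.
  have sub : square_core e `<=` square by move=> p [].
  exact: continuous_subspaceW sub (@pt_continuous R G h g).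
exact: compact_square_core.
Qed.

(** Avoiding [near_vertex r] is a closed condition; a strictly larger radius leaves a margin in
    which the point can move. *)
Lemma open_away r : open [set p | exists2 r1, r < r1 <= eta & ~ near_vertex r1 p].
Proof.
rewrite openE => p [r1 /andP[rr1 r1K] np].
apply: (@filterS _ _ _ [set p' | close ((r1 - r) / 2) p' p]); last first.
  apply: open_nbhs_nbhs; split; first exact: open_close.
  by apply: close_refl; lra.
move=> p' pp'; exists ((r1 + r) / 2); first by apply/andP; split; lra.
move=> [b [s [i c]]]; apply: np; exists b, s, i.
have -> : r1 = (r1 - r) / 2 + (r1 + r) / 2 by field.
by apply: close_trans c; rewrite close_sym.
Qed.

(** A point of [L] avoids the cusp of some radius [r], and points near it avoid cusps of radius
    above [r / 2]; compactness makes the radius uniform. *)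
Lemma cusp_avoids_compact (L : set cover) : compact L ->
  exists2 e, 0 < e <= eta & cusp e `<=` ~` L.
Proof.
move=> /compact_near_coveringP cL.
have [x Lx|e0 /= e00 e0P] := cL R 0^'+ (fun e x => ~ cusp e x) _.
  have [g [p [sp ->]]] := coverP x.
  have [r1 r10 pr1] := near_vertex_bound sp.
  pose r := Num.min r1 eta.
  have r0 : 0 < r by rewrite lt_min r10 pow2_gt0.
  have rK : r <= eta by rewrite ge_min lexx orbT.
  have pr : ~ near_vertex r p.
    by move=> /near_vertex_le pr; apply/pr1/pr; rewrite ge_min lexx.
  clearbody r; pose U : set cover := [set y | exists2 r1, r / 2 < r1 <= eta & ~ cusp r1 y].
  have nU : nbhs (pt g p : cover) U.
    apply: open_nbhs_nbhs; split; last first.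
      by exists r; [apply/andP; split; lra|rewrite cuspP].
    pose V (_ : G) := [set p | exists2 r1, r / 2 < r1 <= eta & ~ near_vertex r1 p].
    apply: (@open_cover _ _ _ V) => [g'|g' p' sp']; first exact: open_away.
    by split=> -[r2 r2b np]; exists r2 => //; move: np; case/andP: r2b => _ r2K;
      rewrite cuspP.
  exists (U, [set e | e < r / 2]) => /=; first split.
  - exact: nU.
  - by apply: nbhs_right_lt; lra.
  - move=> [y e] /= [[r2 /andP[rr2 _] ny] er]; apply: contra_not ny.
    by apply: cusp_le; lra.
pose e := Num.min (e0 / 2) eta.
have ee : 0 < e <= e0 / 2 by rewrite lt_min pow2_gt0 divr_gt0//= ge_min lexx.
have eK : e <= eta by rewrite ge_min lexx orbT.
clearbody e; case/andP: ee => e1 e2; exists e; first by rewrite e1.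
move=> x ex Lx; apply: (e0P e _ _ x Lx ex) => //=.
by rewrite sub0r normrN ger0_norm; lra.
Qed.

Notation linked e x y := (connected_component (cusp e) x y).

Lemma linked_segment e g p q : e <= eta -> straight_segment p q `<=` square ->
  straight_segment p q `<=` near_vertex e -> linked e (pt g p) (pt g q).
Proof.
move=> eK pqs pqe.
have segp : straight_segment p q p.
  by apply/segmentP; exists 0; split; [lra|ring|ring].
have segq : straight_segment p q q.
  by apply/segmentP; exists 1; split; [lra|ring|ring].
apply: (@connected_component_max _ _ (pt g @` straight_segment p q)).
- by exists p.
- by move=> _ [z zpq <-]; apply/cuspP => //; [exact: pqs|exact: pqe].
- apply: connected_continuous_connected; first exact: straight_segment_connected.
  exact: continuous_subspaceW pqs (@pt_continuous R G h g).
- by exists q.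
Qed.

(** The radius grows as in [class_nbhd_path]; this also keeps every piece inside [cusp e]. *)
Lemma linked_path e r g0 x y l : path_length x y l -> r + l <= e -> e <= eta ->
  class_nbhd r g0 x -> linked e x y.
Proof.
move=> xy re eK; elim: xy r re => {x y l} [x|g p q y l pq xy IH] r re xr.
  apply: connected_component_refl.
  by exists g0; move: xr; apply: class_nbhd_le; rewrite addr0 in re.
have l0 := path_length_ge0 xy.
have d0 : 0 <= euclid_dist (set_val p) (set_val q) by exact: sqrtr_ge0.
have rK : r <= eta by lra.
move: xr; rewrite -pt_val => /(class_nbhdP h0 evenK shiftK sumK _ _ rK (set_valP p)).
move=> [b [s [i [c gH]]]].
have cq := close_move (set_val q) c.
apply: (@connected_component_trans _ _ (pt g (set_val q))).
  apply: linked_segment => // z zpq; exists b, s, i.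
  apply: (@close_le _ (r + euclid_dist (set_val p) (set_val q))); first by lra.
  rewrite close_sym; apply: close_segment zpq; rewrite close_sym//.
  by apply: close_le c; rewrite lerDl.
rewrite pt_val; apply: (IH (r + euclid_dist (set_val p) (set_val q))).
  by lra.
exists g, (set_val q); split; [exact: set_valP|by rewrite pt_val|].
by exists b, s, i.
Qed.

Lemma linked_short e r d g0 x y : short d x y -> r + d <= e -> e <= eta ->
  class_nbhd r g0 x -> linked e x y.
Proof.
move=> [l xy ld] rd eK; apply: linked_path xy _ eK.
by apply: le_trans rd; rewrite lerD2l.
Qed.

Lemma class_vertex_pt g b s i d r : 0 < d < r -> d < 2^- i ->
  class_nbhd r (g + offset b s i) (pt g (vertex_pt b s i d)).
Proof.
move=> /andP[d0 dr] di; exists g, (vertex_pt b s i d); split=> //.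
  by apply: open_square_sub; apply: vertex_pt_in; rewrite d0.
exists b, s, i; split; first by apply: close_vertex_pt; rewrite d0.
by rewrite subrr; exact: subgroup0.
Qed.

Lemma linked_vertex_pt e g b s i p d : e <= eta -> square p ->
  close e p (vertex R b s i) -> 0 < d < e -> d < 2^- i ->
  linked e (pt g p) (pt g (vertex_pt b s i d)).
Proof.
move=> eK sp c /andP[d0 de] di; apply: linked_segment => //.
  rewrite straight_segment_sym; apply: segment_sub_square => //.
  by apply: vertex_pt_in; rewrite d0.
move=> z zpq; exists b, s, i; rewrite close_sym.
apply: close_segment zpq; first by rewrite close_sym.
by rewrite close_sym; apply: close_vertex_pt; rewrite d0.
Qed.

(** The chain is followed away from index 0. The constant 6 is 2 for the radius about the current
    vertex plus 4 for the length of a turn. *)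
Lemma linked_chain e g b s i n d : e <= eta -> 0 < d -> 6 * d <= e ->
  d < 2^- (i + n).+2 -> exists g',
  linked e (pt g (vertex_pt b s i d)) (pt g' (vertex_pt b (s (+) odd n) (i + n) d)).
Proof.
move=> eK d0 de; elim: n => [|n IH] dn.
  exists g; rewrite addbF addn0; apply: connected_component_refl.
  exists (g + offset b s i); apply: class_vertex_pt; first by rewrite d0; lra.
  by apply: lt_le_trans dn _; apply: pow2_le; lia.
have dn1 : d < 2^- (i + n).+2.
  by apply: lt_le_trans dn _; apply: pow2_le; lia.
have d01 : 0 < d < 2^- (i + n).+2 by rewrite d0.
have [g' gg'] := IH dn1.
have d2 : 0 < d < 2 * d by rewrite d0; lra.
have dn2 : d < 2^- (i + n) by apply: lt_le_trans dn1 _; apply: pow2_le; lia.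
have stay := class_vertex_pt g' b (s (+) odd n) d2 dn2.
have de6 : 2 * d + 4 * d <= e by lra.
rewrite addnS /= addbN; case: (s (+) odd n) gg' stay => gg' stay.
  exists (g' - edge_shift h b (i + n)); apply: connected_component_trans gg' _.
  apply: linked_short de6 eK stay; apply: short_sym.
  have := short_vertexS h (g' - edge_shift h b (i + n)) b d01.
  by rewrite subrK.
exists (g' + edge_shift h b (i + n)); apply: connected_component_trans gg' _.
exact: linked_short (short_vertex h g' b d01) de6 eK stay.
Qed.

Lemma linked_corner e x : 0 < e -> e <= eta -> cusp e x ->
  exists g n0, forall n, (n0 <= n)%N -> linked e x (corner_seq R h g n).
Proof.
move=> e0 eK; have [g [p [sp ->]]] := coverP x => /(cuspP g eK sp)[b [s [i c]]].
have e4 : 0 < e / 4 by rewrite divr_gt0.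
have [m me] := pow2_small e4.
(* A large index makes the final stretch short, and adding [s] gives [n] the parity of [s], so that
   the chain stops on a side meeting the lower right corner. *)
pose n := (m.*2 + s)%N.
have ne : 2^- (i + n) < e / 4.
  by apply: le_lt_trans me; apply: pow2_le; rewrite /n -addnn; lia.
pose d := Num.min (2^- (i + n).+3) (e / 8).
have d0 : 0 < d by rewrite lt_min pow2_gt0 divr_gt0.
have dn : d < 2^- (i + n).+2 by rewrite gt_min pow2_lt ltnSn.
have de : 6 * d <= e by have : d <= e / 8 by [rewrite ge_min lexx orbT]; lra.
clearbody d.
have di : d < 2^- i.
  by apply: lt_le_trans dn _; apply: pow2_le; lia.
have din : d < 2^- (i + n).
  by apply: lt_le_trans dn _; apply: pow2_le; lia.
have [g' gg'] := linked_chain g b s eK d0 de dn.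
exists g', (i + n)%N => k nk; apply: connected_component_trans.
  by apply: (linked_vertex_pt _ eK sp c _ di); rewrite d0; lra.
apply: connected_component_trans gg' _.
have -> : s (+) odd n = false by rewrite /n oddD odd_double oddb addbb.
have d2 : 0 < d < 2 * d by rewrite d0; lra.
have dd : 0 < d < 2^- (i + n) by rewrite d0.
have sh : short (2 * 2^- (i + n)) (pt g' (vertex_pt b false (i + n) d))
    (corner_seq R h g' k).
  by rewrite corner_seqE (corner_ptE R b); exact/short_sym/short_corner.
apply: (linked_short sh _ eK (class_vertex_pt g' b false d2 din)).
by lra.
Qed.

Lemma class_nbhd_sub e g0 g1 : g1 - g0 \in H -> class_nbhd e g1 `<=` class_nbhd e g0.
Proof.
move=> gg x [g [p [sp xE [b [s [i [c gH]]]]]]]; exists g, p; split=> //.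
by exists b, s, i; split=> //; exact: subgroup_trans gH gg.
Qed.

Lemma class_nbhd_inj e g0 g1 x : e <= eta ->
  class_nbhd e g0 x -> class_nbhd e g1 x -> g1 - g0 \in H.
Proof.
move=> eK; have [g [p [sp ->]]] := coverP x.
move=> /(class_nbhdP h0 evenK shiftK sumK _ _ eK sp)[b [s [i [c gH]]]].
move=> /(class_nbhdP h0 evenK shiftK sumK _ _ eK sp)[b' [s' [i' [c' gH']]]].
have c2 : close (e + e) (vertex R b s i) (vertex R b' s' i').
  by apply: close_trans c'; rewrite close_sym.
have eeK : e + e <= 2^- K.+1 by rewrite (pow2S R K.+1) lerD.
have cH := offset_close h0 evenK shiftK sumK eeK c2.
apply: subgroup_trans (subgroup_sym gH') _.
apply: subgroup_trans gH; rewrite opprD addrACA subrr add0r.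
exact: subgroup_sym cH.
Qed.

(** Inside [cusp e] the class neighbourhoods are open, and disjoint for distinct classes; each is
    therefore also closed there, and a component stays in one of them. *)
Lemma linked_class e g0 x y : e <= eta -> linked e x y -> class_nbhd e g0 x ->
  class_nbhd e g0 y.
Proof.
move=> eK xy xg; have ex : cusp e x by exists g0.
pose C := connected_component (cusp e) x.
suff CE : C `&` class_nbhd e g0 = C.
  by have : C y := xy; rewrite -CE => -[].
apply: (@component_connected _ (cusp e) x).
- by exists x; split=> //; exact: connected_component_refl.
- by exists (class_nbhd e g0) => //; exact: open_class_nbhd.
exists (~` \bigcup_(g1 in [set g1 | g1 - g0 \notin H]) class_nbhd e g1).
  by apply/open_closedC/bigcup_open => g1 _; exact: open_class_nbhd.
apply/seteqP; split=> z [Cz zg]; split=> //.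
  by move=> [g1 /= /negP g1N zg1]; apply: g1N; exact: class_nbhd_inj zg zg1.
have [g1 zg1] := connected_component_sub Cz.
have [gg|gg] := boolP (g1 - g0 \in H); first exact: class_nbhd_sub gg _ zg1.
by exfalso; apply: zg; exists g1.
Qed.

(** Each point is linked to the late corner points of some copy; the two copies are congruent modulo
    [H], and [identifiedH] gives a short path between their corners. *)
Lemma linked_same_class e g0 x y : 0 < e -> e <= eta ->
  class_nbhd e g0 x -> class_nbhd e g0 y -> linked e x y.
Proof.
move=> e0 eK xg yg.
have [g1 [n1 xP]] := linked_corner e0 eK (ex_intro _ g0 xg).
have [g2 [n2 yP]] := linked_corner e0 eK (ex_intro _ g0 yg).
have e2 : 0 < e / 2 by rewrite divr_gt0.
have e2K : e / 2 <= eta by lra.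
have [m me] := pow2_small e2.
have small n : (m <= n)%N -> 2^- n.+1 < e / 2.
  by move=> mn; apply: le_lt_trans me; apply: pow2_le; exact: leqW.
have cornerH z g n : (m <= n)%N -> class_nbhd e g0 z ->
    linked e z (corner_seq R h g n) -> g - g0 \in H.
  move=> mn zg /(linked_class eK)/(_ zg).
  by rewrite corner_class//; have := small n mn; lra.
have g1H : g1 - g0 \in H.
  by apply: (cornerH x _ (maxn m n1)) => //; [exact: leq_maxl|apply/xP/leq_maxr].
have g2H : g2 - g0 \in H.
  by apply: (cornerH y _ (maxn m n2)) => //; [exact: leq_maxl|apply/yP/leq_maxr].
have g12 : g1 - g2 \in H := subgroup_trans g1H (subgroup_sym g2H).
have /identifiedP/(_ _ e2)[n3 g12P] := identifiedH g12.
pose n := maxn (maxn n1 n2) (maxn m n3).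
have [[n1n n2n] [mn n3n]] : ((n1 <= n)%N * (n2 <= n)%N) * ((m <= n)%N * (n3 <= n)%N).
  by rewrite /n !leq_max !leqnn !orbT.
apply: connected_component_trans (xP n n1n) _.
apply: connected_component_trans; last exact/connected_component_sym/yP/n2n.
apply: (@linked_short _ (e / 2) _ g1 _ _ (g12P n n3n)) => //; first by lra.
by apply/corner_class; rewrite ?small//; rewrite subrr; exact: subgroup0.
Qed.

Lemma component_class e g0 x : 0 < e -> e <= eta -> class_nbhd e g0 x ->
  connected_component (cusp e) x = class_nbhd e g0.
Proof.
move=> e0 eK xg; apply/seteqP; split=> y xy; first exact: linked_class xy xg.
exact: linked_same_class xg xy.
Qed.

Lemma class_corner e g : 0 < e -> e <= eta ->
  exists m, forall n, (m <= n)%N -> class_nbhd e g (corner_seq R h g n).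
Proof.
move=> e0 eK; have [m me] := pow2_small e0; exists m => n mn.
apply/corner_class => //; last by rewrite subrr; exact: subgroup0.
by apply: le_lt_trans me; apply: pow2_le; exact: leqW.
Qed.

Lemma connected_componentS (A B : set cover) x y : A `<=` B ->
  connected_component A x y -> connected_component B x y.
Proof. by move=> AB [C [Cx CA cC] Cy]; exists C => //; split=> // z /CA/AB. Qed.

(** The component that finally contains the corner points of copy [g]; the conjunct [compact L]
    produces the value [set0] that [is_end] prescribes elsewhere. *)
Definition corner_end g (L : set cover) : set cover := [set y | compact L /\
  \forall n \near \oo, connected_component (~` L) (corner_seq R h g n) y].

Lemma corner_endE g (L : set cover) e x : compact L -> 0 < e -> e <= eta ->
  cusp e `<=` ~` L -> class_nbhd e g x ->
  corner_end g L = connected_component (~` L) x.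
Proof.
move=> cL e0 eK eL xg; have [m mP] := class_corner g e0 eK.
have same n : (m <= n)%N ->
    connected_component (~` L) (corner_seq R h g n) = connected_component (~` L) x.
  move=> mn; apply/same_connected_component/(connected_componentS eL).
  exact: linked_same_class (mP n mn) xg.
apply/seteqP; split=> y.
  by move=> [_ [k _ /(_ (maxn m k))]]; rewrite /= leq_maxr same ?leq_maxl//; apply.
by move=> xy; split=> //; exists m => // n /= mn; rewrite same.
Qed.

Lemma corner_end_near g (L : set cover) : compact L -> exists e x,
  [/\ 0 < e, e <= eta, cusp e `<=` ~` L, class_nbhd e g x
    & corner_end g L = connected_component (~` L) x].
Proof.
move=> cL; have [e /andP[e0 eK] eL] := cusp_avoids_compact cL.
have [m /(_ m (leqnn m)) xg] := class_corner g e0 eK.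
by exists e, (corner_seq R h g m); split=> //; exact: corner_endE eL xg.
Qed.

Lemma is_end_corner_end g : is_end (corner_end g).
Proof.
split=> [L cL|L M cL cM LM|L ncL].
- have [e [x [e0 eK eL xg ->]]] := corner_end_near g cL.
  by exists x => //; apply: eL; exists g.
- have [e [x [e0 eK eM xg ->]]] := corner_end_near g cM.
  have ML : ~` M `<=` ~` L by exact: subsetC.
  rewrite (corner_endE cL e0 eK _ xg); last exact: subset_trans eM ML.
  by move=> y; exact: connected_componentS.
- by rewrite -subset0 => y [].
Qed.

Lemma corner_end_core g e : 0 < e -> e <= eta ->
  corner_end g (~` cusp e) = class_nbhd e g.
Proof.
move=> e0 eK; have [m /(_ m (leqnn m)) xg] := class_corner g e0 eK.
rewrite (corner_endE (compact_core e0 eK) e0 eK _ xg) setCK//.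
exact: component_class.
Qed.

Lemma corner_end_inj g g' : corner_end g = corner_end g' -> g - g' \in H.
Proof.
move=> gg'; have [m /(_ m (leqnn m)) xg] := class_corner g (pow2_gt0 _ _) (lexx eta).
have xg' := xg; move: xg'; rewrite -(corner_end_core g (pow2_gt0 _ _) (lexx eta)).
rewrite gg' (corner_end_core g' (pow2_gt0 _ _) (lexx eta)) => xg'.
exact: class_nbhd_inj xg' xg.
Qed.

Lemma eq_corner_end g g' : g - g' \in H -> corner_end g = corner_end g'.
Proof.
move=> gH; apply/funext => L; have [cL|ncL] := pselect (compact L).
  have [e [x [e0 eK eL xg ->]]] := corner_end_near g cL.
  by rewrite (corner_endE cL e0 eK eL (class_nbhd_sub gH xg)).
by apply/seteqP; split=> y [].
Qed.

Lemma end_corner_end (E : set cover -> set cover) : is_end E ->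
  exists g, E = corner_end g.
Proof.
move=> [Ecomp Esub Enc].
have core e : 0 < e -> e <= eta -> exists g, E (~` cusp e) = class_nbhd e g.
  move=> e0 eK; have [x] := Ecomp _ (compact_core e0 eK).
  by rewrite setCK => -[g xg] ->; exists g; exact: component_class.
have [g Eg] := core _ (pow2_gt0 _ _) (lexx eta).
have {}core e : 0 < e -> e <= eta -> E (~` cusp e) = class_nbhd e g.
  move=> e0 eK; have [g' Eg'] := core _ e0 eK.
  have [m /(_ m (leqnn m)) xg'] := class_corner g' e0 eK.
  have sub : class_nbhd e g' `<=` class_nbhd eta g.
    rewrite -Eg -Eg'; apply: Esub; [exact: compact_core|exact: compact_core|].
    exact/subsetC/cusp_le.
  have gg' : g' - g \in H.
    by apply: class_nbhd_inj (lexx eta) (sub _ xg') _; exact: class_nbhd_le xg'.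
  rewrite Eg'; apply/seteqP; split; apply: class_nbhd_sub => //.
  exact: subgroup_sym.
exists g; apply/funext => L; have [cL|ncL] := pselect (compact L); last first.
  by rewrite Enc//; apply/esym; rewrite -subset0 => y [].
have [e [x [e0 eK eL xg ->]]] := corner_end_near g cL.
have [z _ Ez] := Ecomp _ cL.
have : E L x.
  apply: (Esub _ _ cL (compact_core e0 eK)); last by rewrite core.
  by apply: subsetCr; exact: eL.
by rewrite Ez => /same_connected_component.
Qed.

(** The index counts right cosets, and a representative of each coset gives one end. *)
Lemma ends_card : ends cover #= `I_(#|[set: G]%SET : H|%g).
Proof.
pose F (i : 'I_#|rcosets H [set: G]%SET|) := corner_end (repr (enum_val i)).
have -> : ends cover = F @` [set: 'I_#|rcosets H [set: G]%SET|].
  apply/seteqP; split=> [E /end_corner_end [g ->]|_ [i _ <-]]; last exact: is_end_corner_end.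
  have gH : (H :* g)%g \in rcosets H [set: G]%SET.
    by apply/rcosetsP; exists g.
  exists (enum_rank_in gH (H :* g)%g) => //; rewrite /F enum_rankK_in//.
  apply: eq_corner_end.
  have := mem_repr_rcoset H g.
  by rewrite mem_rcoset.
apply: (@card_eq_trans _ _ _ _ [set: 'I_#|rcosets H [set: G]%SET|]); last first.
  by rewrite card_eq_sym; exact: card_II.
apply: inj_card_eq => i j _ _ /corner_end_inj ij; apply: enum_val_inj.
have /rcosetsP[a _ ia] := enum_valP i; have /rcosetsP[b _ jb] := enum_valP j.
rewrite ia jb -(rcoset_repr H a) -(rcoset_repr H b) -ia -jb.
by apply/rcoset_eqP; rewrite mem_rcoset.
Qed.

End Ends.

(** * Accumulation points and the generators of the corner subgroup *)

Section Accumulation.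
Variables (G : finZmodType) (h : int -> G) (N : nat).

Lemma accumulation_point_ge (u : nat -> G) g : accumulation_point u g ->
  forall m, exists2 n, (m < n)%N & u n = g.
Proof.
move=> uinf m; apply: contrapT => no; apply: uinf.
apply: sub_finite_set (finite_II m.+1) => n [_ un] /=.
by rewrite ltnS leqNgt; apply/negP => mn; apply: no; exists n.
Qed.

Lemma accumulation_edges g : g \in accumulation_points h ->
  forall m, exists b i, (m <= i)%N /\ edge_shift h b i = g.
Proof.
rewrite inE => /asboolP[] /accumulation_point_ge acc m.
  (* The shift of segment [i] is the term of index [i.+1]; index 0 contradicts [m < n]. *)
  by have [[//|i] mi hi] := acc m; exists false, i.
by have [[//|i] mi hi] := acc m; exists true, i.
Qed.

Hypothesis hN : forall n, (N <= n)%N ->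
  accumulation_point (pos_part h) (h n%:Z) /\
  accumulation_point (neg_part h) (h (- n%:Z)).

Lemma mem_accumulation_points n : (N <= n)%N ->
  (h n%:Z \in accumulation_points h) && (h (- n%:Z) \in accumulation_points h).
Proof.
by move=> /hN[pos neg]; rewrite !inE; apply/andP; split; apply/asboolP; [left|right].
Qed.

Lemma accumulation_sub_corner g g' :
  g \in accumulation_points h -> g' \in accumulation_points h ->
  g - g' \in corner_subgroup h N.
Proof. move=> gA g'A; apply: mem_gen; rewrite inE; apply/orP; right.
by apply/imset2P; exists g g'. Qed.

Lemma edge_shift_sub_corner b b' i j : (N <= i)%N -> (N <= j)%N ->
  edge_shift h b i - edge_shift h b' j \in corner_subgroup h N.
Proof.
move=> Ni Nj.
have /andP[ip im] := mem_accumulation_points (leqW Ni).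
have /andP[jp jm] := mem_accumulation_points (leqW Nj).
by case: b b' => -[]; exact: accumulation_sub_corner.
Qed.

(** Past [N], each step adds, up to sign, a difference of two accumulation points. *)
Lemma alternating_sum_sub_corner n : (N <= n)%N ->
  alternating_sum h n \in corner_subgroup h N.
Proof.
move=> /subnK <-; elim: (n - N)%N => [|k IH].
  by apply: mem_gen; rewrite !inE eqxx.
rewrite addSn alternating_sumS; apply: subgroupD => //; rewrite subgroup_sign.
have /andP[kp _] := mem_accumulation_points (leq_addl k N).
have /andP[_ km] := mem_accumulation_points (leqW (leq_addl k N)).
exact: accumulation_sub_corner.
Qed.

Lemma corner_subgroup_identified (R : realType) : h 0 = 0 ->
  corner_subgroup h N \subset identified_shifts R h.
Proof.
move=> h0; rewrite gen_subG; apply/fintype.subsetP => g.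
have diff a c : a \in accumulation_points h -> c \in accumulation_points h ->
    a - c \in identified_shifts R h.
  by move=> aA cA; apply: identified_edges; exact: accumulation_edges.
rewrite in_setU1 => /orP[/eqP ->|/imset2P[a c aA cA ->]]; last exact: diff.
apply: identified_alternating_sum => // n Nn.
have /andP[np _] := mem_accumulation_points Nn.
have /andP[_ nm] := mem_accumulation_points (leqW Nn).
exact: diff.
Qed.

End Accumulation.

Theorem proposition8p5 (R : realType) (G : finZmodType) (h : int -> G)
  (hB : basic_seqs h) (N : nat)
  (hN : forall n : nat, (N <= n)%N ->
     accumulation_point (pos_part h) (h n%:Z) /\
     accumulation_point (neg_part h) (h (- n%:Z))) :
  (forall g g' : G,
     lower_right_corners_identified R h g g' <->
     g - g' \in corner_subgroup h N) /\
  ends (chamanara_cover R h) #= `I_(#|[set: G]%SET : corner_subgroup h N|%g).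
Proof.
case: hB => _ h0.
(* Doubling [N] gives an even base index [K] for the classes, still at least [N]. *)
have evenK : ~~ odd N.*2 by rewrite odd_double.
have NK : (N <= N.*2)%N by rewrite -addnn leq_addl.
have shiftK b b' i j : (N.*2 <= i)%N -> (N.*2 <= j)%N ->
    edge_shift h b i - edge_shift h b' j \in corner_subgroup h N.
  by move=> /(leq_trans NK) Ni /(leq_trans NK) Nj; exact: edge_shift_sub_corner.
have sumK := alternating_sum_sub_corner hN (leqW NK).
have /fintype.subsetP sub := corner_subgroup_identified hN R h0.
have idH g g' : g - g' \in corner_subgroup h N ->
    lower_right_corners_identified R h g g'.
  move=> /subgroup_sym /sub.
  by move=> /identified_shiftsP/(_ g); rewrite addrCA subrr addr0.
split=> [g g'|]; last exact: (ends_card h0 evenK shiftK sumK idH).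
by split=> [|/idH//]; exact: (identified_class h0 evenK shiftK sumK).
Qed.
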